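(* For every $x\in\mathbb{C}$, $$e^{3x/2}\sum_{n\in\mathbb{Z}}I_n^3(x)=\int_0^\infty I_0^3\left(\sqrt{2xt}\right)e^{-t}\,dt .$$
   Context: For $n\in\mathbb{Z}$, $I_n$ is the modified Bessel function of the first kind of order $n$: $I_n(x)=\sum_{k=0}^\infty\frac{1}{k!\,(k+n)!}\left(\frac{x}{2}\right)^{2k+n}$, $x\in\mathbb{C}$, with the usual convention that $1/m!=0$ for negative integers $m$ (so $I_{-n}=I_n$). $I_n^3(x)$ means $(I_n(x))^3$. Since $I_0$ is even, $I_0(\sqrt{2xt})$ does not depend on the choice of the square root. *)

(* Defs.v *)
From Stdlib Require Import Reals ZArith Lra Psatz.
From Coquelicot Require Import Coquelicot.
Open Scope C_scope.

Definition Cexp (z : C) : C :=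
  RtoC (exp (Re z)) * (cos (Im z), sin (Im z)).

(* Sum of a convergent complex series, taken componentwise (Coquelicot's
   [Series] is total but real-valued). *)
Definition CSeries (a : nat -> C) : C :=
  (Series (fun k => Re (a k)), Series (fun k => Im (a k))).

(* 1 / m!, with the convention 1 / m! = 0 for m < 0 *)
Definition inv_fact (m : Z) : R :=
  if (m <? 0)%Z then 0%R else (/ INR (fact (Z.to_nat m)))%R.

(* The truncation [Z.to_nat] of the exponent 2k+n is harmless: 2k+n < 0 forces
   k+n < 0, and the coefficient is then 0. *)
Definition BesselI_term (n : Z) (x : C) (k : nat) : C :=
  RtoC (inv_fact (Z.of_nat k) * inv_fact (Z.of_nat k + n))
  * (x / 2) ^ Z.to_nat (2 * Z.of_nat k + n).

Definition BesselI (n : Z) (x : C) : C := CSeries (BesselI_term n x).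

(* The family (a n), n in Z, is absolutely summable with sum [l]; absolute
   convergence makes the sum independent of the order of summation. *)
Definition is_Zsum (a : Z -> C) (l : C) : Prop :=
  ex_series (fun k : nat => Cmod (a (Z.of_nat k))) /\
  ex_series (fun k : nat => Cmod (a (- Z.of_nat (S k))%Z)) /\
  exists lp ln : C,
    is_series (fun k : nat => a (Z.of_nat k)) lp /\
    is_series (fun k : nat => a (- Z.of_nat (S k))%Z) ln /\
    l = lp + ln.

(* Absolutely convergent improper integral of a complex-valued function over
   [0, +oo); for functions Riemann integrable on every [0, b] this is the
   Lebesgue integral. *)
Definition is_CInt_0_infty (f : R -> C) (l : C) : Prop :=
  ex_RInt_gen (fun t => Cmod (f t)) (at_point 0%R) (Rbar_locally p_infty) /\
  is_RInt_gen (V := C_R_NormedModule) f (at_point 0%R) (Rbar_locally p_infty) l.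

Definition is_sqrt_fun (s : C -> C) : Prop := forall z : C, s z * s z = z.

Lemma is_sqrt_fun_exists : exists s : C -> C, is_sqrt_fun s.
Proof.
exists (fun z => (sqrt ((Cmod z + Re z) / 2),
   if Rlt_dec (Im z) 0 then (- sqrt ((Cmod z - Re z) / 2))%R
   else sqrt ((Cmod z - Re z) / 2))).
intros [a b]; simpl.
assert (Ha : (Rabs a <= Cmod (a, b))%R).
{ apply Rle_trans with (2 := Rmax_Cmod (a, b)); apply Rmax_l. }
assert (Hm : (Cmod (a, b) * Cmod (a, b) = a * a + b * b)%R).
{ unfold Cmod; simpl; rewrite sqrt_sqrt; nra. }
set (m := Cmod (a, b)) in *; clearbody m.
apply Rabs_le_between in Ha.
set (p := sqrt ((m + a) / 2)); set (q := sqrt ((m - a) / 2)).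
assert (Hp : (p * p = (m + a) / 2)%R) by (apply sqrt_sqrt; lra).
assert (Hq : (q * q = (m - a) / 2)%R) by (apply sqrt_sqrt; lra).
assert (Hpq : (2 * (p * q) = Rabs b)%R).
{ unfold p, q; rewrite <- sqrt_mult by lra.
  replace ((m + a) / 2 * ((m - a) / 2))%R with (Rsqr (b / 2)) by (unfold Rsqr; nra).
  rewrite sqrt_Rsqr_abs. unfold Rdiv; rewrite Rabs_mult, (Rabs_pos_eq (/ 2)); lra. }
unfold Cmult; simpl; destruct (Rlt_dec b 0) as [Hb | Hb].
- rewrite Rabs_left in Hpq by lra; f_equal; lra.
- rewrite Rabs_pos_eq in Hpq by lra; f_equal; lra.
Qed.

(* Main.v *)
(* Put y = x/2. The derivative of I_n with respect to y is I_(n-1) + I_(n+1),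
   so the coefficients of the products I_a I_b I_c, summed over the diagonal
   shifts (a,b,c) + n(1,1,1), count walks on the triangular lattice Z^3 /
   Z(1,1,1). Multiplying by e^(3y) makes the walk lazy, and the step
   polynomial factors: 3 plus the six steps is (1+u+v)(1+1/u+1/v). Hence the
   k-th coefficient is a closed form, k! times a sum over r1+r2+r3 = k of
   1/(r1! r2! r3! s1! s2! s3!) with s - r = (c-a, a-b, b-c), because both
   sides satisfy the same recurrence in k with the same initial value. At a =
   b = c the closed form is k! times the coefficient of (yt)^k in
   I_0(sqrt(2xt))^3, and the factor k! is produced by the Laplace integral of
   t^k.

   To avoid infinite sums over n in the recurrence, n is restricted to the
   window |n| <= L, which changes only coefficients of order > L near the
   origin. *)
Require Import Defs.
From Stdlib Require Import Reals ZArith Lra Lia.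
From Coquelicot Require Import Coquelicot.
Local Open Scope R_scope.

(** * Reciprocal factorials on the integers *)

Lemma inv_fact_nneg (m : Z) : 0 <= inv_fact m.
Proof.
unfold inv_fact; destruct (m <? 0)%Z; [lra|].
left; apply Rinv_0_lt_compat, INR_fact_lt_0.
Qed.

Lemma inv_fact_nat (n : nat) : inv_fact (Z.of_nat n) = / INR (fact n).
Proof.
unfold inv_fact; destruct (Z.ltb_spec (Z.of_nat n) 0); [lia|].
now rewrite Nat2Z.id.
Qed.

Lemma inv_fact_neg (m : Z) : (m < 0)%Z -> inv_fact m = 0.
Proof. intros Hm; unfold inv_fact; now destruct (Z.ltb_spec m 0); [|lia]. Qed.

(** The convention 1/m! = 0 for m < 0 makes both sides vanish at m = 0, so the recurrences below
    need no boundary cases. *)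
Lemma inv_fact_pred (m : Z) : IZR m * inv_fact m = inv_fact (m - 1).
Proof.
destruct (Z.lt_trichotomy m 0) as [Hm | [-> | Hm]].
- rewrite !inv_fact_neg by lia; ring.
- rewrite (inv_fact_neg (0 - 1)) by lia; ring.
- replace m with (Z.of_nat (S (Z.to_nat (m - 1)))) by lia.
  set (n := Z.to_nat (m - 1)).
  replace (Z.of_nat (S n) - 1)%Z with (Z.of_nat n) by lia.
  rewrite !inv_fact_nat, fact_simpl, mult_INR, <- INR_IZR_INZ.
  field; split; [apply INR_fact_neq_0 | apply not_0_INR; lia].
Qed.

(** * Coefficients *)

Lemma PS_mult_ext (f f' g g' : nat -> R) (n : nat) :
  (forall k, f k = f' k) -> (forall k, g k = g' k) ->
  PS_mult f g n = PS_mult f' g' n.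
Proof. intros Hf Hg; apply sum_eq; intros k _; now rewrite Hf, Hg. Qed.

Lemma PS_mult_plus_l (f f' g : nat -> R) (n : nat) :
  PS_mult (fun k => f k + f' k) g n = PS_mult f g n + PS_mult f' g n.
Proof. unfold PS_mult; rewrite <- plus_sum; apply sum_eq; intros; ring. Qed.

Lemma PS_mult_plus_r (f g g' : nat -> R) (n : nat) :
  PS_mult f (fun k => g k + g' k) n = PS_mult f g n + PS_mult f g' n.
Proof. unfold PS_mult; rewrite <- plus_sum; apply sum_eq; intros; ring. Qed.

Lemma PS_mult_scal_l (c : R) (f g : nat -> R) (n : nat) :
  PS_mult (fun k => c * f k) g n = c * PS_mult f g n.
Proof. unfold PS_mult; rewrite scal_sum; apply sum_eq; intros; ring. Qed.

Lemma PS_mult_scal_r (c : R) (f g : nat -> R) (n : nat) :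
  PS_mult f (fun k => c * g k) n = c * PS_mult f g n.
Proof. unfold PS_mult; rewrite scal_sum; apply sum_eq; intros; ring. Qed.

Lemma PS_mult_nneg (f g : nat -> R) (n : nat) :
  (forall k, 0 <= f k) -> (forall k, 0 <= g k) -> 0 <= PS_mult f g n.
Proof.
intros Hf Hg; apply cond_pos_sum; intros k; now apply Rmult_le_pos.
Qed.

(** The weight n splits as k + (n - k) in every term of the convolution: y d/dy is a derivation. *)
Lemma PS_mult_euler (f g : nat -> R) (n : nat) :
  INR n * PS_mult f g n =
  PS_mult (fun k => INR k * f k) g n + PS_mult f (fun k => INR k * g k) n.
Proof.
unfold PS_mult; rewrite scal_sum, <- plus_sum; apply sum_eq; intros k Hk.
rewrite (minus_INR n k) by lia; ring.
Qed.

(** Leibniz rule, read off from [PS_mult_euler] at index n + 1: in each sum the end term of weight 0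
    drops out. *)
Lemma PS_derive_mult (f g : nat -> R) (n : nat) :
  PS_derive (PS_mult f g) n =
  PS_mult (PS_derive f) g n + PS_mult f (PS_derive g) n.
Proof.
unfold PS_derive at 1; rewrite PS_mult_euler; f_equal; unfold PS_mult.
- rewrite decomp_sum by lia; simpl pred.
  change (INR 0) with 0; rewrite !Rmult_0_l, Rplus_0_l.
  apply sum_eq; intros k Hk; now unfold PS_derive; replace (S n - S k)%nat with (n - k)%nat by lia.
- rewrite tech5, Nat.sub_diag; change (INR 0) with 0.
  rewrite Rmult_0_l, Rmult_0_r, Rplus_0_r.
  apply sum_eq; intros k Hk; unfold PS_derive.
  now replace (S n - k)%nat with (S (n - k)) by lia.
Qed.

(** * Power series coefficients of the Bessel functions *)

(** Coefficient of y^k in I_n, where y = x/2. The index is the power of y, not the summation index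
    of the Bessel series, so that products and derivatives act directly on the coefficients. *)
Definition bessel_coef (n : Z) (k : nat) : R :=
  if Z.even (Z.of_nat k + n)
  then inv_fact ((Z.of_nat k - n) / 2) * inv_fact ((Z.of_nat k + n) / 2)
  else 0.

Lemma bessel_coef_even (n : Z) (k : nat) (i j : Z) :
  (i + j = Z.of_nat k)%Z -> (j - i = n)%Z ->
  bessel_coef n k = inv_fact i * inv_fact j.
Proof.
intros Hk Hn; unfold bessel_coef.
replace (Z.of_nat k + n)%Z with (j * 2)%Z by lia.
replace (Z.of_nat k - n)%Z with (i * 2)%Z by lia.
rewrite !Z.div_mul by lia.
now rewrite Z.even_mul, Bool.orb_true_r.
Qed.

Lemma bessel_coef_odd (n : Z) (k : nat) (i : Z) :
  (Z.of_nat k + n = 2 * i + 1)%Z -> bessel_coef n k = 0.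
Proof.
intros Hk; unfold bessel_coef; rewrite Hk.
now rewrite Z.add_comm, Z.even_add_mul_2.
Qed.

Lemma bessel_coef_nneg (n : Z) (k : nat) : 0 <= bessel_coef n k.
Proof.
unfold bessel_coef; destruct Z.even; [|lra].
apply Rmult_le_pos; apply inv_fact_nneg.
Qed.

Lemma bessel_coef_0 (n : Z) : bessel_coef n 0 = if Z.eq_dec n 0 then 1 else 0.
Proof.
destruct (Z.eq_dec n 0) as [-> | Hn].
- rewrite (bessel_coef_even 0 0 0 0) by lia.
  change 0%Z with (Z.of_nat 0); rewrite inv_fact_nat; simpl; field.
- destruct (Z.Even_or_Odd n) as [[i Hi] | [i Hi]].
  + rewrite (bessel_coef_even n 0 (- i) i) by lia.
    destruct (Z.lt_trichotomy i 0) as [H | [H | H]]; [| lia |].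
    * rewrite (inv_fact_neg i) by lia; ring.
    * rewrite (inv_fact_neg (- i)) by lia; ring.
  + apply (bessel_coef_odd n 0 i); lia.
Qed.

(** The nonzero coefficients are 1/(i! j!) with i + j = k + 1. The factor k + 1 = i + j cancels once
    against i! and once against j!, which moves n by +1 and by -1. *)
Lemma bessel_coef_derive (n : Z) (k : nat) :
  PS_derive (bessel_coef n) k = bessel_coef (n - 1) k + bessel_coef (n + 1) k.
Proof.
unfold PS_derive.
destruct (Z.Even_or_Odd (Z.of_nat (S k) + n)) as [[j Hj] | [j Hj]].
- set (i := (Z.of_nat (S k) - j)%Z).
  rewrite (bessel_coef_even n (S k) i j), (bessel_coef_even (n - 1) k i (j - 1)),
    (bessel_coef_even (n + 1) k (i - 1) j) by lia.
  rewrite <- !inv_fact_pred, INR_IZR_INZ.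
  replace (Z.of_nat (S k)) with (i + j)%Z by lia.
  rewrite plus_IZR; ring.
- rewrite (bessel_coef_odd n (S k) j), (bessel_coef_odd (n - 1) k (j - 1)),
    (bessel_coef_odd (n + 1) k j) by lia; ring.
Qed.

(** * Products of three Bessel functions as lattice walks *)

Definition bessel3_coef (a b c : Z) : nat -> R :=
  PS_mult (bessel_coef a) (PS_mult (bessel_coef b) (bessel_coef c)).

(** Sum over the six neighbours in Z^3. On functions invariant under the shift by (1,1,1) it is the
    adjacency operator of the triangular lattice. *)
Definition walk_step (f : Z -> Z -> Z -> R) (a b c : Z) : R :=
  f (a - 1)%Z b c + f (a + 1)%Z b c + f a (b - 1)%Z c + f a (b + 1)%Z c
  + f a b (c - 1)%Z + f a b (c + 1)%Z.

Lemma bessel3_coef_derive (a b c : Z) (k : nat) :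
  PS_derive (bessel3_coef a b c) k =
  walk_step (fun a b c => bessel3_coef a b c k) a b c.
Proof.
unfold bessel3_coef, walk_step.
rewrite PS_derive_mult.
rewrite (PS_mult_ext _ _ _ _ k (bessel_coef_derive a) (fun _ => eq_refl)).
rewrite PS_mult_plus_l.
rewrite (PS_mult_ext (bessel_coef a) _ _ _ k (fun _ => eq_refl)
  (PS_derive_mult (bessel_coef b) (bessel_coef c))).
rewrite PS_mult_plus_r.
rewrite (PS_mult_ext (bessel_coef a) _ (PS_mult (PS_derive (bessel_coef b)) _)
  (fun k => PS_mult (bessel_coef (b - 1)) (bessel_coef c) k
          + PS_mult (bessel_coef (b + 1)) (bessel_coef c) k) k (fun _ => eq_refl)).
2: { intros i; rewrite (PS_mult_ext _ _ _ _ i (bessel_coef_derive b) (fun _ => eq_refl)).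
     apply PS_mult_plus_l. }
rewrite (PS_mult_ext (bessel_coef a) _ (PS_mult _ (PS_derive (bessel_coef c)))
  (fun k => PS_mult (bessel_coef b) (bessel_coef (c - 1)) k
          + PS_mult (bessel_coef b) (bessel_coef (c + 1)) k) k (fun _ => eq_refl)).
2: { intros i; rewrite (PS_mult_ext (bessel_coef b) _ _ _ i (fun _ => eq_refl)
       (bessel_coef_derive c)).
     apply PS_mult_plus_r. }
rewrite !PS_mult_plus_r; unfold PS_mult; ring.
Qed.

Lemma bessel3_coef_nneg (a b c : Z) (k : nat) : 0 <= bessel3_coef a b c k.
Proof.
apply PS_mult_nneg; [|intros i; apply PS_mult_nneg]; apply bessel_coef_nneg.
Qed.

(** * Sums over a finite window of diagonal shifts *)

(** The addition is a parameter because the same sum over |n| <= L is taken of real coefficients, of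
    complex values and in abstract modules. *)
Fixpoint window_sum {T : Type} (add : T -> T -> T) (L : nat) (f : Z -> T) : T :=
  match L with
  | O => f 0%Z
  | S l => add (add (window_sum add l f) (f (Z.of_nat L))) (f (- Z.of_nat L)%Z)
  end.

Lemma window_sum_ext (L : nat) (f g : Z -> R) :
  (forall n, f n = g n) -> window_sum Rplus L f = window_sum Rplus L g.
Proof. intros H; induction L as [|L IH]; simpl; now rewrite ?IH, !H. Qed.

Lemma window_sum_plus (L : nat) (f g : Z -> R) :
  window_sum Rplus L (fun n => f n + g n) = window_sum Rplus L f + window_sum Rplus L g.
Proof. induction L as [|L IH]; simpl; rewrite ?IH; ring. Qed.

Lemma window_sum_scal (L : nat) (r : R) (f : Z -> R) :
  window_sum Rplus L (fun n => r * f n) = r * window_sum Rplus L f.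
Proof. induction L as [|L IH]; simpl; rewrite ?IH; ring. Qed.

Lemma window_sum_nneg (L : nat) (f : Z -> R) :
  (forall n, 0 <= f n) -> 0 <= window_sum Rplus L f.
Proof.
intros H; induction L as [|L IH]; simpl; [apply H|].
repeat apply Rplus_le_le_0_compat; auto.
Qed.

Lemma window_sum_le (L : nat) (f g : Z -> R) :
  (forall n, f n <= g n) -> window_sum Rplus L f <= window_sum Rplus L g.
Proof.
intros H; induction L as [|L IH]; simpl; [apply H|].
repeat apply Rplus_le_compat; auto.
Qed.

Lemma window_sum_single (L : nat) (f : Z -> R) (m : Z) :
  (forall n, n <> m -> f n = 0) ->
  window_sum Rplus L f = if (Z.abs m <=? Z.of_nat L)%Z then f m else 0.
Proof.
intros H; induction L as [|L IH].
- destruct (Z.leb_spec (Z.abs m) (Z.of_nat 0)); simpl.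
  + f_equal; lia.
  + apply H; lia.
- cbn [window_sum]; rewrite IH.
  destruct (Z.leb_spec (Z.abs m) (Z.of_nat L));
    destruct (Z.leb_spec (Z.abs m) (Z.of_nat (S L))); try lia.
  + rewrite (H (Z.of_nat (S L))), (H (- Z.of_nat (S L))%Z) by lia; ring.
  + destruct (Z.le_gt_cases 0 m).
    * replace (Z.of_nat (S L)) with m by lia; rewrite (H (- m)%Z) by lia; ring.
    * replace (Z.of_nat (S L)) with (- m)%Z by lia.
      rewrite (H (- m)%Z), Z.opp_involutive by lia; ring.
  + rewrite (H (Z.of_nat (S L))), (H (- Z.of_nat (S L))%Z) by lia; ring.
Qed.

(** Times k!, this is the number of walks of length k in Z^3 from the origin to one of the points
    (a,b,c) + n(1,1,1) with |n| <= L. *)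
Definition walk_coef (L : nat) (a b c : Z) (k : nat) : R :=
  window_sum Rplus L (fun n => bessel3_coef (a + n) (b + n) (c + n) k).

(** Diagonal shifts commute with [walk_step], so the recurrence is exact for every finite window.
    The truncation is visible only in the initial values. *)
Lemma walk_coef_derive (L : nat) (a b c : Z) (k : nat) :
  PS_derive (walk_coef L a b c) k =
  walk_step (fun a b c => walk_coef L a b c k) a b c.
Proof.
unfold PS_derive, walk_coef; rewrite <- window_sum_scal.
unfold walk_step; rewrite <- !window_sum_plus; apply window_sum_ext; intros n.
change (INR (S k) * bessel3_coef (a + n) (b + n) (c + n) (S k))
  with (PS_derive (bessel3_coef (a + n) (b + n) (c + n)) k).
rewrite bessel3_coef_derive; unfold walk_step.
replace (a - 1 + n)%Z with (a + n - 1)%Z by lia.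
replace (b - 1 + n)%Z with (b + n - 1)%Z by lia.
replace (c - 1 + n)%Z with (c + n - 1)%Z by lia.
replace (a + 1 + n)%Z with (a + n + 1)%Z by lia.
replace (b + 1 + n)%Z with (b + n + 1)%Z by lia.
replace (c + 1 + n)%Z with (c + n + 1)%Z by lia.
reflexivity.
Qed.

Lemma walk_coef_nneg (L : nat) (a b c : Z) (k : nat) : 0 <= walk_coef L a b c k.
Proof. apply window_sum_nneg; intros n; apply bessel3_coef_nneg. Qed.

Lemma walk_coef_0 (L : nat) (a b c : Z) :
  walk_coef L a b c 0 =
  if Z.eq_dec a b then if Z.eq_dec b c then
    if (Z.abs a <=? Z.of_nat L)%Z then 1 else 0
  else 0 else 0.
Proof.
unfold walk_coef.
assert (H : forall n, bessel3_coef (a + n) (b + n) (c + n) 0 =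
  bessel_coef (a + n) 0 * (bessel_coef (b + n) 0 * bessel_coef (c + n) 0)) by reflexivity.
(* Only the shift n = -a can bring (a,b,c) to the origin. *)
rewrite (window_sum_single L _ (- a)%Z).
2: { intros n Hn; rewrite H, (bessel_coef_0 (a + n)).
     destruct (Z.eq_dec (a + n) 0); [lia | ring]. }
rewrite Z.abs_opp, H, !bessel_coef_0.
destruct (Z.eq_dec (a + - a) 0); [|lia].
destruct (Z.leb_spec (Z.abs a) (Z.of_nat L)); repeat destruct Z.eq_dec; try lia; ring.
Qed.

Lemma walk_coef_0_le (L : nat) (a b c : Z) : walk_coef L a b c 0 <= 1.
Proof.
rewrite walk_coef_0.
destruct (Z.eq_dec a b); [destruct (Z.eq_dec b c); [destruct Z.leb|]|]; lra.
Qed.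

(** * The lazy walk: multiplication by e^(3y) *)

Definition exp3_coef (k : nat) : R := 3 ^ k / INR (fact k).

Lemma exp3_coef_derive (k : nat) : PS_derive exp3_coef k = 3 * exp3_coef k.
Proof.
unfold PS_derive, exp3_coef; rewrite fact_simpl, mult_INR; simpl pow.
field; split; [apply INR_fact_neq_0 | apply not_0_INR; lia].
Qed.

Lemma exp3_coef_nneg (k : nat) : 0 <= exp3_coef k.
Proof.
apply Rmult_le_pos; [apply pow_le; lra | left; apply Rinv_0_lt_compat, INR_fact_lt_0].
Qed.

Definition lazy_walk_coef (L : nat) (a b c : Z) : nat -> R :=
  PS_mult exp3_coef (walk_coef L a b c).

(** In the Leibniz rule the derivative of e^(3y) contributes the weight 3 of standing still, the
    other factor contributes the six steps. *)
Lemma lazy_walk_coef_derive (L : nat) (a b c : Z) (k : nat) :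
  PS_derive (lazy_walk_coef L a b c) k =
  3 * lazy_walk_coef L a b c k + walk_step (fun a b c => lazy_walk_coef L a b c k) a b c.
Proof.
unfold lazy_walk_coef; rewrite PS_derive_mult.
rewrite (PS_mult_ext _ _ _ _ k exp3_coef_derive (fun _ => eq_refl)), PS_mult_scal_l.
rewrite (PS_mult_ext exp3_coef _ _ _ k (fun _ => eq_refl) (walk_coef_derive L a b c)).
unfold walk_step; rewrite !PS_mult_plus_r; unfold PS_mult; ring.
Qed.

Lemma lazy_walk_coef_nneg (L : nat) (a b c : Z) (k : nat) : 0 <= lazy_walk_coef L a b c k.
Proof.
apply PS_mult_nneg; [apply exp3_coef_nneg | apply walk_coef_nneg].
Qed.

Lemma lazy_walk_coef_0 (L : nat) (a b c : Z) : lazy_walk_coef L a b c 0 = walk_coef L a b c 0.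
Proof. unfold lazy_walk_coef, PS_mult, exp3_coef; simpl; field. Qed.

(** * The closed form and its recurrence *)

(** For d = 0 these are the coefficients of I_0(w) in powers of y when w^2 = 4y. *)
Definition fact_coef (d : Z) (k : nat) : R :=
  inv_fact (Z.of_nat k) * inv_fact (Z.of_nat k + d).

Lemma fact_coef_derive (d : Z) (k : nat) :
  PS_derive (fact_coef d) k = fact_coef (d + 1) k.
Proof.
unfold PS_derive, fact_coef; rewrite INR_IZR_INZ, <- Rmult_assoc, inv_fact_pred.
f_equal; f_equal; lia.
Qed.

(** Write k = (k + d) - d and cancel k + d against (k + d)!. [fact_coef_derive] cancels against the
    other factorial. *)
Lemma fact_coef_euler (d : Z) (k : nat) :
  INR k * fact_coef d k = fact_coef (d - 1) k + - IZR d * fact_coef d k.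
Proof.
unfold fact_coef.
replace (Z.of_nat k + (d - 1))%Z with (Z.of_nat k + d - 1)%Z by lia.
rewrite <- (inv_fact_pred (Z.of_nat k + d)), plus_IZR, INR_IZR_INZ; ring.
Qed.

(** Sum over r1 + r2 + r3 = k of 1/(r1! r2! r3! s1! s2! s3!), where the differences s_i - r_i are d,
    e, f. If d + e + f = 0, the s_i also add up to k. *)
Definition fact3_coef (d e f : Z) : nat -> R :=
  PS_mult (fact_coef d) (PS_mult (fact_coef e) (fact_coef f)).

Lemma fact3_coef_derive (d e f : Z) (k : nat) :
  PS_derive (fact3_coef d e f) k =
  fact3_coef (d + 1) e f k + fact3_coef d (e + 1) f k + fact3_coef d e (f + 1) k.
Proof.
unfold fact3_coef; rewrite PS_derive_mult.
rewrite (PS_mult_ext _ _ _ _ k (fact_coef_derive d) (fun _ => eq_refl)).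
rewrite (PS_mult_ext (fact_coef d) _ _ _ k (fun _ => eq_refl)
  (PS_derive_mult (fact_coef e) (fact_coef f))), PS_mult_plus_r.
rewrite (PS_mult_ext (fact_coef d) _ (PS_mult (PS_derive _) _) 
  (PS_mult (fact_coef (e + 1)) (fact_coef f)) k (fun _ => eq_refl)).
2: { intros i; apply PS_mult_ext; [apply fact_coef_derive | easy]. }
rewrite (PS_mult_ext (fact_coef d) _ (PS_mult _ (PS_derive _)) 
  (PS_mult (fact_coef e) (fact_coef (f + 1))) k (fun _ => eq_refl)).
2: { intros i; apply PS_mult_ext; [easy | apply fact_coef_derive]. }
ring.
Qed.

(** Here k is written as s1 + s2 + s3, and each s_i cancels against s_i!. The corrections -d, -e, -f
    from the three factors add up to 0. *)
Lemma fact3_coef_euler (d e f : Z) (k : nat) : (d + e + f = 0)%Z ->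
  INR k * fact3_coef d e f k =
  fact3_coef (d - 1) e f k + fact3_coef d (e - 1) f k + fact3_coef d e (f - 1) k.
Proof.
intros Hs; unfold fact3_coef; rewrite PS_mult_euler.
rewrite (PS_mult_ext _ _ _ _ k (fact_coef_euler d) (fun _ => eq_refl)).
rewrite (PS_mult_ext (fact_coef d) _ _ _ k (fun _ => eq_refl)
  (PS_mult_euler (fact_coef e) (fact_coef f))), PS_mult_plus_r.
rewrite (PS_mult_ext (fact_coef d) _ (PS_mult (fun k => INR k * _) _) 
  (fun k => PS_mult (fact_coef (e - 1)) (fact_coef f) k 
    + - IZR e * PS_mult (fact_coef e) (fact_coef f) k) k (fun _ => eq_refl)).
2: { intros i; rewrite (PS_mult_ext _ _ _ _ i (fact_coef_euler e) (fun _ => eq_refl)).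
     now rewrite PS_mult_plus_l, PS_mult_scal_l. }
rewrite (PS_mult_ext (fact_coef d) _ (PS_mult _ (fun k => INR k * _)) 
  (fun k => PS_mult (fact_coef e) (fact_coef (f - 1)) k 
    + - IZR f * PS_mult (fact_coef e) (fact_coef f) k) k (fun _ => eq_refl)).
2: { intros i; rewrite (PS_mult_ext (fact_coef e) _ _ _ i (fun _ => eq_refl) (fact_coef_euler f)).
     now rewrite PS_mult_plus_r, PS_mult_scal_r. }
rewrite !PS_mult_plus_r, PS_mult_plus_l, PS_mult_scal_l, !PS_mult_scal_r.
replace (IZR f) with (- IZR d - IZR e).
2: { replace f with (- d - e)%Z by lia; now rewrite minus_IZR, opp_IZR. }
unfold PS_mult; ring.
Qed.

(* On the term indexed by (r, s), one factor k+1 is written as the sum of the r_i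
   and the other as the sum of the s_j; the nine products r_i s_j give the right side. *)
Lemma fact3_coef_derive2 (d e f : Z) (k : nat) : (d + e + f = 0)%Z ->
  INR (S k) * PS_derive (fact3_coef d e f) k =
  3 * fact3_coef d e f k
  + fact3_coef (d - 1) (e + 1) f k + fact3_coef (d - 1) e (f + 1) k
  + fact3_coef (d + 1) (e - 1) f k + fact3_coef d (e - 1) (f + 1) k
  + fact3_coef (d + 1) e (f - 1) k + fact3_coef d (e + 1) (f - 1) k.
Proof.
intros Hs; unfold PS_derive; rewrite (fact3_coef_euler d e f (S k) Hs).
rewrite !Rmult_plus_distr_l.
change (INR (S k) * fact3_coef (d - 1) e f (S k)) with (PS_derive (fact3_coef (d - 1) e f) k).
change (INR (S k) * fact3_coef d (e - 1) f (S k)) with (PS_derive (fact3_coef d (e - 1) f) k).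
change (INR (S k) * fact3_coef d e (f - 1) (S k)) with (PS_derive (fact3_coef d e (f - 1)) k).
rewrite !fact3_coef_derive.
rewrite !Z.sub_add; ring.
Qed.

(** If d + e + f = 0, then k! times this is a sum of products of two multinomial coefficients, hence
    a coefficient of the k-th power of (1+u+v)(1+1/u+1/v). *)
Definition table_coef (d e f : Z) (k : nat) : R := INR (fact k) * fact3_coef d e f k.

(** Moving one of a, b, c by one changes two of the differences c-a, a-b, b-c in opposite
    directions. The six neighbours thus match the six mixed terms of [fact3_coef_derive2]. *)
Lemma table_coef_derive (a b c : Z) (k : nat) :
  PS_derive (table_coef (c - a) (a - b) (b - c)) k =
  3 * table_coef (c - a) (a - b) (b - c) k +
  walk_step (fun a b c => table_coef (c - a) (a - b) (b - c) k) a b c.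
Proof.
unfold walk_step.
replace (c - (a - 1))%Z with (c - a + 1)%Z by lia.
replace (c - (a + 1))%Z with (c - a - 1)%Z by lia.
replace (a - (b - 1))%Z with (a - b + 1)%Z by lia.
replace (a - (b + 1))%Z with (a - b - 1)%Z by lia.
replace (b - (c - 1))%Z with (b - c + 1)%Z by lia.
replace (b - (c + 1))%Z with (b - c - 1)%Z by lia.
replace (c - 1 - a)%Z with (c - a - 1)%Z by lia.
replace (c + 1 - a)%Z with (c - a + 1)%Z by lia.
replace (a - 1 - b)%Z with (a - b - 1)%Z by lia.
replace (a + 1 - b)%Z with (a - b + 1)%Z by lia.
replace (b - 1 - c)%Z with (b - c - 1)%Z by lia.
replace (b + 1 - c)%Z with (b - c + 1)%Z by lia.
assert (H := fact3_coef_derive2 (c - a) (a - b) (b - c) k ltac:(lia)).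
unfold table_coef; unfold PS_derive in *.
rewrite fact_simpl, mult_INR.
(* One factor k + 1 belongs to the derivative, the other comes from (k+1)! = (k+1) k!. *)
transitivity (INR (fact k) *
  (INR (S k) * (INR (S k) * fact3_coef (c - a) (a - b) (b - c) (S k)))); [ring|].
rewrite H; ring.
Qed.

(** The three differences add up to 0, so unless all vanish one is negative and its reciprocal
    factorial is 0. *)
Lemma table_coef_0 (a b c : Z) :
  table_coef (c - a) (a - b) (b - c) 0 =
  if Z.eq_dec a b then if Z.eq_dec b c then 1 else 0 else 0.
Proof.
unfold table_coef, fact3_coef, fact_coef, PS_mult.
cbn [sum_f_R0 Nat.sub fact INR]; change (Z.of_nat 0) with 0%Z; rewrite !Z.add_0_l.
change (inv_fact 0) with (/ 1).
assert (H : inv_fact (c - a) * inv_fact (a - b) * inv_fact (b - c) =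
  if Z.eq_dec a b then if Z.eq_dec b c then 1 else 0 else 0).
{ destruct (Z.eq_dec a b) as [<- | Hab]; [destruct (Z.eq_dec a c) as [<- | Hac]|].
  - rewrite Z.sub_diag; change (inv_fact 0) with (/ 1); field.
  - destruct (Z.lt_trichotomy a c) as [?|[?|?]]; [| lia |].
    + rewrite (inv_fact_neg (a - c)) by lia; ring.
    + rewrite (inv_fact_neg (c - a)) by lia; ring.
  - destruct (Z.lt_ge_cases (a - b) 0); [rewrite (inv_fact_neg (a - b)) by lia; ring|].
    destruct (Z.lt_ge_cases (b - c) 0); [rewrite (inv_fact_neg (b - c)) by lia; ring|].
    rewrite (inv_fact_neg (c - a)) by lia; ring. }
rewrite <- H; field.
Qed.

(** * Comparison of the two sides and growth bounds *)

(** Both sides satisfy the same recurrence in k. Each step back to order k - 1 moves a by at most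
    one, so at order 0 the position is still inside the window, where the initial values agree. *)
Lemma lazy_walk_coef_eq_table (L k : nat) (a b c : Z) :
  (Z.abs a + Z.of_nat k <= Z.of_nat L)%Z ->
  lazy_walk_coef L a b c k = table_coef (c - a) (a - b) (b - c) k.
Proof.
revert a b c; induction k as [|k IH]; intros a b c Hk.
- rewrite lazy_walk_coef_0, walk_coef_0, table_coef_0.
  destruct (Z.leb_spec (Z.abs a) (Z.of_nat L)); [easy | lia].
- apply (Rmult_eq_reg_l (INR (S k))); [|apply not_0_INR; lia].
  assert (Hl := lazy_walk_coef_derive L a b c k).
  assert (Ht := table_coef_derive a b c k).
  unfold PS_derive in Hl, Ht; rewrite Hl, Ht.
  unfold walk_step; rewrite !IH by lia; reflexivity.
Qed.

(** One step has total weight m + 6: resting plus six neighbours. The bound does not depend on the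
    position, and in the applications not on the window either, so it survives L -> infinity. *)
Lemma walk_bound (f : nat -> Z -> Z -> Z -> R) (m : R) :
  0 <= m ->
  (forall a b c, f O a b c <= 1) ->
  (forall k a b c, INR (S k) * f (S k) a b c = m * f k a b c + walk_step (f k) a b c) ->
  forall k a b c, f k a b c <= (m + 6) ^ k / INR (fact k).
Proof.
intros Hm H0 HS k; induction k as [|k IH]; intros a b c.
- simpl; rewrite Rdiv_1_r; apply H0.
- apply (Rmult_le_reg_l (INR (S k))); [apply lt_0_INR; lia|].
  rewrite HS.
  replace (INR (S k) * ((m + 6) ^ S k / INR (fact (S k))))
    with ((m + 6) * ((m + 6) ^ k / INR (fact k))).
  2: { rewrite fact_simpl, mult_INR; simpl pow; field.
       split; [apply INR_fact_neq_0 | apply not_0_INR; lia]. }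
  set (q := _ / _) in *; unfold walk_step.
  apply Rle_trans with (m * q + (q + q + q + q + q + q)); [|right; ring].
  apply Rplus_le_compat; [now apply Rmult_le_compat_l|].
  repeat apply Rplus_le_compat; apply IH.
Qed.

Lemma walk_coef_le (L : nat) (a b c : Z) (k : nat) :
  walk_coef L a b c k <= 6 ^ k / INR (fact k).
Proof.
replace 6 with (0 + 6) by ring.
apply (walk_bound (fun k a b c => walk_coef L a b c k) 0); [lra | |].
- intros a' b' c'; apply walk_coef_0_le.
- intros k' a' b' c'; rewrite Rmult_0_l, Rplus_0_l.
  apply (walk_coef_derive L a' b' c' k').
Qed.

Lemma lazy_walk_coef_le (L : nat) (a b c : Z) (k : nat) :
  lazy_walk_coef L a b c k <= 9 ^ k / INR (fact k).
Proof.
replace 9 with (3 + 6) by ring.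
apply (walk_bound (fun k a b c => lazy_walk_coef L a b c k) 3); [lra | |].
- intros a' b' c'; rewrite lazy_walk_coef_0; apply walk_coef_0_le.
- intros k' a' b' c'; apply (lazy_walk_coef_derive L a' b' c' k').
Qed.

Lemma bessel_coef_le (n : Z) (k : nat) : bessel_coef n k <= 2 ^ k / INR (fact k).
Proof.
revert n; induction k as [|k IH]; intros n.
- rewrite bessel_coef_0; simpl; destruct Z.eq_dec; lra.
- apply (Rmult_le_reg_l (INR (S k))); [apply lt_0_INR; lia|].
  assert (H := bessel_coef_derive n k); unfold PS_derive in H; rewrite H.
  replace (INR (S k) * (2 ^ S k / INR (fact (S k)))) with
    (2 ^ k / INR (fact k) + 2 ^ k / INR (fact k)).
  2: { rewrite fact_simpl, mult_INR; simpl pow; field.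
       split; [apply INR_fact_neq_0 | apply not_0_INR; lia]. }
  apply Rplus_le_compat; apply IH.
Qed.

(** * Absolutely convergent complex series *)

Lemma sum_n_C (a : nat -> C) (n : nat) :
  sum_n a n = (sum_n (fun k => fst (a k)) n, sum_n (fun k => snd (a k)) n).
Proof.
induction n as [|n IH]; [rewrite !sum_O; now destruct (a O)|].
now rewrite !sum_Sn, IH.
Qed.

Lemma fst_sum_n (a : nat -> C) (n : nat) :
  fst (sum_n a n) = sum_n (fun k => fst (a k)) n.
Proof. now rewrite sum_n_C. Qed.

Lemma snd_sum_n (a : nat -> C) (n : nat) :
  snd (sum_n a n) = sum_n (fun k => snd (a k)) n.
Proof. now rewrite sum_n_C. Qed.

Lemma is_series_C (a : nat -> C) (l : C) :
  is_series a l <->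
  is_series (fun k => fst (a k)) (fst l) /\ is_series (fun k => snd (a k)) (snd l).
Proof.
unfold is_series; split.
- intros H; split; apply filterlim_locally; intros eps;
    generalize (proj1 (filterlim_locally _ _) H eps); apply filter_imp;
    intros n Hn; rewrite sum_n_C in Hn; apply Hn.
- intros [H1 H2]; apply filterlim_locally; intros eps.
  generalize (filter_and _ _ (proj1 (filterlim_locally _ _) H1 eps)
    (proj1 (filterlim_locally _ _) H2 eps)); apply filter_imp; intros n Hn.
  now rewrite sum_n_C.
Qed.

Lemma CSeries_unique (a : nat -> C) (l : C) : is_series a l -> CSeries a = l.
Proof.
intros H; apply is_series_C in H; destruct H as [H1 H2].
unfold CSeries, Re, Im; rewrite (is_series_unique _ _ H1), (is_series_unique _ _ H2).
now destruct l.
Qed.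

Lemma is_series_C_unique (a : nat -> C) (l l' : C) :
  is_series a l -> is_series a l' -> l = l'.
Proof. intros H H'; now rewrite <- (CSeries_unique a l), (CSeries_unique a l'). Qed.

Lemma Cmod_snd (z : C) : Rabs (snd z) <= Cmod z.
Proof. eapply Rle_trans, Rmax_Cmod; apply Rmax_r. Qed.

Lemma ex_series_le_R (a b : nat -> R) :
  (forall k, Rabs (a k) <= b k) -> ex_series b -> ex_series a.
Proof. apply (ex_series_le (V := R_CompleteNormedModule)). Qed.

(** Convergence of the moduli is carried along with the sum because Cauchy products need it. *)
Definition abs_series (a : nat -> C) (l : C) : Prop :=
  ex_series (fun k => Cmod (a k)) /\ is_series a l.

Lemma ex_abs_series (a : nat -> C) (b : nat -> R) :
  (forall k, Cmod (a k) <= b k) -> ex_series b -> exists l, abs_series a l.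
Proof.
intros Hab Hb.
assert (H : ex_series (fun k => Cmod (a k))).
{ apply (ex_series_le_R _ b); [|easy]; intros k.
  
  now rewrite Rabs_pos_eq by apply Cmod_ge_0. }
assert (H1 : ex_series (fun k => fst (a k))).
{ apply (ex_series_le_R _ (fun k => Cmod (a k))); [|easy]; intros k; apply re_le_Cmod. }
assert (H2 : ex_series (fun k => snd (a k))).
{ apply (ex_series_le_R _ (fun k => Cmod (a k))); [|easy]; intros k; apply Cmod_snd. }
destruct H1 as [l1 H1], H2 as [l2 H2].
exists (l1, l2); split; [easy | now apply is_series_C].
Qed.

Lemma abs_series_ext (a b : nat -> C) (l : C) :
  (forall k, a k = b k) -> abs_series a l -> abs_series b l.
Proof.
intros H [H1 H2]; split.
- apply (ex_series_ext (fun k => Cmod (a k))); [|easy]; intros k; now rewrite H.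
- now apply (is_series_ext a).
Qed.

Lemma Cmod_sum_n (a : nat -> C) (n : nat) :
  Cmod (sum_n a n) <= sum_n (fun k => Cmod (a k)) n.
Proof.
induction n as [|n IH]; [rewrite !sum_O; lra|].
rewrite !sum_Sn; eapply Rle_trans; [apply Cmod_triangle|].
now apply Rplus_le_compat_r.
Qed.

Lemma Cmod_is_series_le (a : nat -> C) (b : nat -> R) (l : C) (s : R) :
  is_series a l -> is_series b s -> (forall k, Cmod (a k) <= b k) -> Cmod l <= s.
Proof.
intros Ha Hb Hab.
assert (H : is_lim_seq (fun n => Cmod (sum_n a n)) (Cmod l)).
{ apply (filterlim_comp _ _ _ (sum_n a) Cmod eventually (locally l)); [easy|].
  apply (filterlim_norm (V := C_NormedModule)). }
apply (is_lim_seq_le (fun n => Cmod (sum_n a n)) (sum_n b) (Cmod l) s); [|easy|easy].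
intros n; eapply Rle_trans; [apply Cmod_sum_n|].
now apply sum_n_m_le.
Qed.

(** Real and imaginary part of the product are a difference and a sum of real Cauchy products, whose
    factors converge absolutely because |Re z| and |Im z| are at most |z|. *)
Lemma abs_series_mult (a b : nat -> C) (la lb : C) :
  abs_series a la -> abs_series b lb ->
  abs_series (fun n => sum_n (fun k => a k * b (n - k)%nat)%C n) (la * lb)%C.
Proof.
intros [Ha Ha'] [Hb Hb'].
assert (Habs : forall f : C -> R, (forall z, Rabs (f z) <= Cmod z) -> forall c : nat -> C,
  ex_series (fun k => Cmod (c k)) -> ex_series (fun k => Rabs (f (c k)))).
{ intros f Hf c Hc; apply (ex_series_le_R _ (fun k => Cmod (c k))); [|easy].
  intros k; 
  now rewrite Rabs_Rabsolu. }
split.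
- assert (Hm : forall c : nat -> C, ex_series (fun k => Cmod (c k)) ->
    ex_series (fun k => Rabs (Cmod (c k)))).
  { intros c; apply ex_series_ext; intros k; now rewrite Rabs_pos_eq by apply Cmod_ge_0. }
  destruct Ha as [sa Hsa], Hb as [sb Hsb].
  assert (H := is_series_mult _ _ _ _ Hsa Hsb (Hm a (ex_intro _ _ Hsa)) (Hm b (ex_intro _ _ Hsb))).
  apply ex_series_le_R with (2 := ex_intro _ _ H); intros n.
  
  rewrite Rabs_pos_eq by apply Cmod_ge_0; rewrite <- sum_n_Reals.
  eapply Rle_trans; [apply Cmod_sum_n|]; right; apply sum_n_ext; intros k.
  apply Cmod_mult.
- apply is_series_C in Ha', Hb'; destruct Ha' as [Ha1 Ha2], Hb' as [Hb1 Hb2].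
  assert (A1 := Habs fst re_le_Cmod _ Ha); assert (A2 := Habs snd Cmod_snd _ Ha).
  assert (B1 := Habs fst re_le_Cmod _ Hb); assert (B2 := Habs snd Cmod_snd _ Hb).
  apply is_series_C; split.
  + generalize (is_series_minus _ _ _ _
      (is_series_mult _ _ _ _ Ha1 Hb1 A1 B1) (is_series_mult _ _ _ _ Ha2 Hb2 A2 B2)).
    apply is_series_ext; intros n.
    rewrite fst_sum_n, sum_n_Reals.
    change (plus ?u (opp ?v)) with (u - v); rewrite <- minus_sum; apply sum_eq; now intros.
  + generalize (is_series_plus _ _ _ _
      (is_series_mult _ _ _ _ Ha1 Hb2 A1 B2) (is_series_mult _ _ _ _ Ha2 Hb1 A2 B1)).
    apply is_series_ext; intros n.
    rewrite snd_sum_n, sum_n_Reals.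
    change (plus ?u ?v) with (u + v); rewrite <- plus_sum; apply sum_eq; now intros.
Qed.

(** * Complex power series with real coefficients *)

Definition pow_term (a : nat -> R) (y : C) (k : nat) : C := (RtoC (a k) * y ^ k)%C.

Lemma Cmod_pow_term (a : nat -> R) (y : C) (k : nat) :
  0 <= a k -> Cmod (pow_term a y k) = a k * Cmod y ^ k.
Proof.
intros H; unfold pow_term; rewrite Cmod_mult, Cmod_pow, Cmod_R.
now rewrite Rabs_pos_eq.
Qed.

Lemma RtoC_sum_n (a : nat -> R) (n : nat) : RtoC (sum_n a n) = sum_n (fun k => RtoC (a k)) n.
Proof.
induction n as [|n IH]; [now rewrite !sum_O|].
rewrite !sum_Sn, <- IH; apply RtoC_plus.
Qed.

Lemma abs_series_pow_mult (a b : nat -> R) (y la lb : C) :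
  abs_series (pow_term a y) la -> abs_series (pow_term b y) lb ->
  abs_series (pow_term (PS_mult a b) y) (la * lb)%C.
Proof.
intros Ha Hb; generalize (abs_series_mult _ _ _ _ Ha Hb).
apply abs_series_ext; intros n; unfold pow_term, PS_mult.
rewrite <- sum_n_Reals, RtoC_sum_n.
rewrite <- (sum_n_mult_r (K := C_Ring)).
apply sum_n_ext_loc; intros k Hk.
replace (y ^ n)%C with (y ^ k * y ^ (n - k))%C.
2: { rewrite <- Cpow_add_r; f_equal; lia. }
rewrite RtoC_mult.
change (a k * y ^ k * (b (n - k)%nat * y ^ (n - k)) =
  a k * b (n - k)%nat * (y ^ k * y ^ (n - k)))%C; ring.
Qed.

Lemma is_series_exp (r : R) : is_series (fun k => r ^ k / INR (fact k)) (exp r).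
Proof.
generalize (is_exp_Reals r); apply is_series_ext; intros k.
rewrite pow_n_pow; reflexivity.
Qed.

Lemma ex_abs_series_pow (a : nat -> R) (A : R) (y : C) :
  (forall k, 0 <= a k <= A ^ k / INR (fact k)) ->
  exists l, abs_series (pow_term a y) l.
Proof.
intros H.
apply (ex_abs_series _ (fun k => (A * Cmod y) ^ k / INR (fact k))).
- intros k; destruct (H k); rewrite Cmod_pow_term by easy.
  unfold Rdiv; rewrite Rpow_mult_distr, Rmult_assoc, (Rmult_comm (Cmod y ^ k)), <- Rmult_assoc.
  apply Rmult_le_compat_r; [apply pow_le, Cmod_ge_0 | easy].
- eexists; apply is_series_exp.
Qed.

(** * Entire series and the complex exponential *)

Lemma CV_radius_infinite (a : nat -> R) (M : R) (r : R) :
  0 <= r -> (forall k, Rabs (a k) <= M * (r ^ k / INR (fact k))) -> CV_radius a = p_infty.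
Proof.
intros Hr H.
assert (Hd : forall x, 0 <= x -> CV_disk a x).
{ intros x Hx; unfold CV_disk.
  apply (ex_series_le_R _ (fun k => M * ((r * x) ^ k / INR (fact k)))).
  - intros k; 
    rewrite Rabs_Rabsolu, Rabs_mult, (Rabs_pos_eq (x ^ k)) by now apply pow_le.
    replace (M * ((r * x) ^ k / INR (fact k)))
      with (M * (r ^ k / INR (fact k)) * x ^ k)
      by (rewrite Rpow_mult_distr; unfold Rdiv; ring).
    apply Rmult_le_compat_r; [now apply pow_le | easy].
  - eexists; apply (is_series_scal (K := R_AbsRing) (V := R_NormedModule) M), is_series_exp. }
unfold CV_radius; destruct (Lub_Rbar_correct (CV_disk a)) as [Hu _].
destruct (Lub_Rbar (CV_disk a)) as [u| |]; [|easy|].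
- exfalso; assert (H0 := Hu _ (Hd (Rmax 0 (u + 1)) (Rmax_l _ _))).
  simpl in H0; assert (H1 := Rmax_r 0 (u + 1)); lra.
- exfalso; apply (Hu _ (Hd 0 (Rle_refl 0))).
Qed.

(** The system says (P + iQ)' = (al + i be)(P + iQ), so (P + iQ) e^(-(al + i be)t) is constant. This
    links the exponential series to the definition of [Cexp] by cosine and sine. *)
Lemma linear_system_rotation (P Q : R -> R) (al be : R) :
  (forall t, is_derive P t (al * P t - be * Q t)) ->
  (forall t, is_derive Q t (be * P t + al * Q t)) ->
  P 0 = 1 -> Q 0 = 0 ->
  P 1 = exp al * cos be /\ Q 1 = exp al * sin be.
Proof.
intros HP HQ HP0 HQ0.
assert (EP : forall t, ex_derive P t) by (intros t; eexists; apply HP).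
assert (EQ : forall t, ex_derive Q t) by (intros t; eexists; apply HQ).
assert (DP : forall t, Derive P t = al * P t - be * Q t)
  by (intros t; now apply is_derive_unique).
assert (DQ : forall t, Derive Q t = be * P t + al * Q t)
  by (intros t; now apply is_derive_unique).
(* [G1] and [G2] are the real and the imaginary part of that constant. *)
pose (G1 := fun t => exp (- (al * t)) * (cos (be * t) * P t + sin (be * t) * Q t)).
pose (G2 := fun t => exp (- (al * t)) * (cos (be * t) * Q t - sin (be * t) * P t)).
assert (H1 : G1 0 = G1 1).
{ apply eq_is_derive; [intros t _ | lra].
  unfold G1; auto_derive; [now repeat split|].
  change (Derive (fun x => P x) t) with (Derive P t).
  change (Derive (fun x => Q x) t) with (Derive Q t).
  rewrite DP, DQ; change zero with 0; ring. }
assert (H2 : G2 0 = G2 1).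
{ apply eq_is_derive; [intros t _ | lra].
  unfold G2; auto_derive; [now repeat split|].
  change (Derive (fun x => P x) t) with (Derive P t).
  change (Derive (fun x => Q x) t) with (Derive Q t).
  rewrite DP, DQ; change zero with 0; ring. }
unfold G1, G2 in H1, H2; rewrite HP0, HQ0 in H1, H2.
rewrite (Rmult_0_r al), (Rmult_0_r be), Ropp_0, exp_0, cos_0, sin_0 in H1, H2.
rewrite !Rmult_1_r in H1, H2.
assert (He : exp al * exp (- al) = 1) by (rewrite <- exp_plus, Rplus_opp_r; apply exp_0).
assert (Hc := sin2_cos2 be); unfold Rsqr in Hc.
set (e := exp (- al)) in *; set (E := exp al) in *.
set (c := cos be) in *; set (s := sin be) in *.
assert (A1 : c * P 1 + s * Q 1 = E).
{ transitivity (E * (e * (c * P 1 + s * Q 1))); [rewrite <- Rmult_assoc, He; ring|].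
  rewrite <- H1; ring. }
assert (A2 : c * Q 1 - s * P 1 = 0).
{ transitivity (E * (e * (c * Q 1 - s * P 1))); [rewrite <- Rmult_assoc, He; ring|].
  rewrite <- H2; ring. }
(* Rotating back by the angle [be] recovers P(1) and Q(1). *)
split.
- transitivity (c * (c * P 1 + s * Q 1) - s * (c * Q 1 - s * P 1)).
  + transitivity ((s * s + c * c) * P 1); [rewrite Hc|]; ring.
  + rewrite A1, A2; ring.
- transitivity (s * (c * P 1 + s * Q 1) + c * (c * Q 1 - s * P 1)).
  + transitivity ((s * s + c * c) * Q 1); [rewrite Hc|]; ring.
  + rewrite A1, A2; ring.
Qed.

Lemma Cpow_components_le (z : C) (k : nat) :
  Rabs (fst (z ^ k)%C) <= Cmod z ^ k /\ Rabs (snd (z ^ k)%C) <= Cmod z ^ k.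
Proof. rewrite <- Cmod_pow; split; [apply re_le_Cmod | apply Cmod_snd]. Qed.

Lemma PS_derive_div_fact (a : nat -> R) (k : nat) :
  PS_derive (fun j => a j / INR (fact j)) k = a (S k) / INR (fact k).
Proof.
unfold PS_derive; rewrite fact_simpl, mult_INR; field.
split; [apply INR_fact_neq_0 | apply not_0_INR; lia].
Qed.

(** A general geometric bound is allowed because this serves both the components of z^k here and the
    Borel transforms below. *)
Lemma CV_radius_div_fact (a : nat -> R) (M r : R) :
  0 <= r -> (forall k, Rabs (a k) <= M * r ^ k) ->
  CV_radius (fun k => a k / INR (fact k)) = p_infty.
Proof.
intros Hr H; apply (CV_radius_infinite _ M r Hr); intros k.
unfold Rdiv; rewrite Rabs_mult, (Rabs_pos_eq (/ _)), <- Rmult_assoc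
  by (left; apply Rinv_0_lt_compat, INR_fact_lt_0).
apply Rmult_le_compat_r; [left; apply Rinv_0_lt_compat, INR_fact_lt_0 | easy].
Qed.

Lemma is_derive_PSeries_div_fact (a : nat -> R) (M r t : R) :
  0 <= r -> (forall k, Rabs (a k) <= M * r ^ k) ->
  is_derive (PSeries (fun k => a k / INR (fact k))) t
    (PSeries (fun k => a (S k) / INR (fact k)) t).
Proof.
intros Hr H.
rewrite <- (PSeries_ext _ _ t (PS_derive_div_fact a)).
apply is_derive_PSeries; now rewrite (CV_radius_div_fact a M r Hr H).
Qed.

Lemma ex_pseries_div_fact (a : nat -> R) (M r t : R) :
  0 <= r -> (forall k, Rabs (a k) <= M * r ^ k) ->
  ex_pseries (fun k => a k / INR (fact k)) t.
Proof.
intros Hr H; apply CV_radius_inside; now rewrite (CV_radius_div_fact a M r Hr H).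
Qed.

Lemma PSeries_div_fact_0 (a : nat -> R) : PSeries (fun k => a k / INR (fact k)) 0 = a O.
Proof. rewrite PSeries_0; simpl; field. Qed.

(** As functions of a real t, the real and imaginary parts P, Q of the series of e^(tz) solve the
    linear system with al + i be = z. The claim is the value at t = 1. *)
Lemma abs_series_Cexp (z : C) :
  abs_series (pow_term (fun k => / INR (fact k)) z) (Cexp z).
Proof.
destruct (ex_abs_series_pow (fun k => / INR (fact k)) 1 z) as [l Hl].
{ intros k; rewrite pow1; split; [left; apply Rinv_0_lt_compat, INR_fact_lt_0 | lra]. }
replace (Cexp z) with l; [easy|].
assert (Hr := Cmod_ge_0 z).
assert (B1 : forall k, Rabs (fst (z ^ k)%C) <= 1 * Cmod z ^ k)
  by (intros k; rewrite Rmult_1_l; apply Cpow_components_le).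
assert (B2 : forall k, Rabs (snd (z ^ k)%C) <= 1 * Cmod z ^ k)
  by (intros k; rewrite Rmult_1_l; apply Cpow_components_le).
pose (P := PSeries (fun k => fst (z ^ k)%C / INR (fact k))).
pose (Q := PSeries (fun k => snd (z ^ k)%C / INR (fact k))).
destruct (linear_system_rotation P Q (fst z) (snd z)) as [H1 H2].
- intros t; unfold P.
  (* Differentiation replaces z^k by z^(k+1), whose real part is Re z Re z^k - Im z Im z^k. *)
  replace (_ - _) with (PSeries (fun k => fst (z ^ S k)%C / INR (fact k)) t).
  { exact (is_derive_PSeries_div_fact (fun k => fst (z ^ k)%C) 1 (Cmod z) t Hr B1). }
  unfold Q; rewrite <- !PSeries_scal, <- PSeries_minus.
  + apply PSeries_ext; intros k; unfold PS_minus, PS_plus, PS_opp, PS_scal.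
    change (plus ?u (opp ?v)) with (u - v); change (scal ?u ?v) with (u * v).
    simpl; unfold Rdiv; ring.
  + apply ex_pseries_scal; [apply Rmult_comm|];
      exact (ex_pseries_div_fact (fun k => fst (z ^ k)%C) 1 (Cmod z) t Hr B1).
  + apply ex_pseries_scal; [apply Rmult_comm|];
      exact (ex_pseries_div_fact (fun k => snd (z ^ k)%C) 1 (Cmod z) t Hr B2).
- intros t; unfold Q.
  replace (_ + _) with (PSeries (fun k => snd (z ^ S k)%C / INR (fact k)) t).
  { exact (is_derive_PSeries_div_fact (fun k => snd (z ^ k)%C) 1 (Cmod z) t Hr B2). }
  unfold P; rewrite <- !PSeries_scal, <- PSeries_plus.
  + apply PSeries_ext; intros k; unfold PS_plus, PS_scal.
    change (plus ?u ?v) with (u + v); change (scal ?u ?v) with (u * v).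
    simpl; unfold Rdiv; ring.
  + apply ex_pseries_scal; [apply Rmult_comm|];
      exact (ex_pseries_div_fact (fun k => fst (z ^ k)%C) 1 (Cmod z) t Hr B1).
  + apply ex_pseries_scal; [apply Rmult_comm|];
      exact (ex_pseries_div_fact (fun k => snd (z ^ k)%C) 1 (Cmod z) t Hr B2).
- apply PSeries_div_fact_0.
- apply PSeries_div_fact_0.
- destruct Hl as [_ Hl]; apply is_series_C in Hl; destruct Hl as [L1 L2].
  rewrite (surjective_pairing l); unfold Cexp, Re, Im, Cmult, RtoC; simpl.
  f_equal.
  + rewrite Rmult_0_l, Rminus_0_r, <- H1; symmetry; apply is_series_unique.
    revert L1; apply is_series_ext; intros k.
    rewrite pow1; unfold pow_term; simpl; unfold Rdiv; ring.
  + rewrite Rmult_0_l, Rplus_0_r, <- H2; symmetry; apply is_series_unique.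
    revert L2; apply is_series_ext; intros k.
    rewrite pow1; unfold pow_term; simpl; unfold Rdiv; ring.
Qed.

Lemma abs_series_exp3 (y : C) : abs_series (pow_term exp3_coef y) (Cexp (3 * y)).
Proof.
generalize (abs_series_Cexp (3 * y)%C); apply abs_series_ext; intros k.
unfold pow_term, exp3_coef, Rdiv.
rewrite Cpow_mult_l, RtoC_mult, <- RtoC_pow; ring.
Qed.

(** * The Bessel functions as power series in x/2 *)

Lemma is_series_drop_zeros (a : nat -> C) (l : C) (m : nat) :
  (forall k, (k < m)%nat -> a k = RtoC 0) ->
  is_series a l <-> is_series (fun k => a (m + k)%nat) l.
Proof.
revert a; induction m as [|m IH]; intros a H; [easy|].
assert (H0 : a O = RtoC 0) by (apply H; lia).
transitivity (is_series (fun k => a (S k)) l).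
- split; intros Ha.
  + apply is_series_incr_1; rewrite H0; change (plus l (RtoC 0)) with (l + 0)%C.
    now rewrite Cplus_0_r.
  + apply is_series_decr_1; rewrite H0; change (plus l (opp (RtoC 0))) with (l + - 0)%C.
    now replace (l + - 0)%C with l by ring.
- apply (IH (fun k => a (S k))); intros k Hk; apply H; lia.
Qed.

Lemma is_series_pairs (a : nat -> C) (l : C) :
  is_series a l -> is_series (fun k => a (2 * k)%nat + a (2 * k + 1)%nat)%C l.
Proof.
intros H.
assert (Hs : forall n, sum_n (fun k => a (2 * k)%nat + a (2 * k + 1)%nat)%C n
  = sum_n a (2 * n + 1)).
{ intros n; induction n as [|n IH].
  - rewrite sum_O; simpl; now rewrite sum_Sn, sum_O.
  - replace (2 * S n + 1)%nat with (S (S (2 * n + 1))) by lia.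
    rewrite !sum_Sn, IH, <- plus_assoc; f_equal.
    change (plus ?u ?v) with (u + v)%C; do 2 f_equal; lia. }
unfold is_series; apply (filterlim_ext (fun n => sum_n a (2 * n + 1))); [easy|].
apply (filterlim_comp _ _ _ (fun n => (2 * n + 1)%nat) (sum_n a) eventually eventually);
  [|exact H].
intros P [N HN]; exists N; intros n Hn; apply HN; lia.
Qed.

Lemma bessel_coef_small (n : Z) (j : nat) :
  (Z.of_nat j < Z.abs n)%Z -> bessel_coef n j = 0.
Proof.
intros Hj; destruct (Z.Even_or_Odd (Z.of_nat j + n)) as [[i Hi] | [i Hi]].
- rewrite (bessel_coef_even n j (i - n) i) by lia.
  destruct (Z.le_gt_cases 0 n).
  + rewrite (inv_fact_neg (i - n)) by lia; ring.
  + rewrite (inv_fact_neg i) by lia; ring.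
- now apply (bessel_coef_odd n j i).
Qed.

(** The Bessel series advances by two powers of x/2 per term, the power series by one. Leading zeros
    are dropped on both sides, and then even and odd orders are paired, the odd member of each pair
    being 0. *)
Lemma abs_series_BesselI (n : Z) (x : C) :
  abs_series (pow_term (bessel_coef n) (x / 2)%C) (BesselI n x).
Proof.
destruct (ex_abs_series_pow (bessel_coef n) 2 (x / 2)%C) as [l Hl].
{ intros k; split; [apply bessel_coef_nneg | apply bessel_coef_le]. }
replace (BesselI n x) with l; [easy|].
symmetry; apply CSeries_unique; destruct Hl as [_ Hl].
apply (is_series_drop_zeros _ _ (Z.to_nat (- n))).
{ intros k Hk; unfold BesselI_term.
  rewrite (inv_fact_neg (Z.of_nat k + n)), Rmult_0_r by lia; ring. }
apply (is_series_drop_zeros _ _ (Z.to_nat (Z.abs n))) in Hl.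
2: { intros k Hk; unfold pow_term; rewrite bessel_coef_small by lia; ring. }
apply is_series_pairs in Hl; revert Hl; apply is_series_ext; intros k.
unfold pow_term, BesselI_term.
set (i := Z.of_nat (Z.to_nat (- n) + k)).
rewrite (bessel_coef_even n _ i (i + n)) by lia.
rewrite (bessel_coef_odd n _ (i + n)) by lia.
(* Since i = max(0,-n) + k, the exponent 2i + n is |n| + 2k. *)
replace (Z.to_nat (2 * i + n)) with (Z.to_nat (Z.abs n) + 2 * k)%nat by lia.
rewrite Cmult_0_l; apply Cplus_0_r.
Qed.

Lemma fact_coef_0_bound (k : nat) : 0 <= fact_coef 0 k <= 1 ^ k / INR (fact k).
Proof.
unfold fact_coef; rewrite Z.add_0_r, inv_fact_nat, pow1.
assert (H : 1 <= INR (fact k)) by (apply (le_INR 1), lt_O_fact).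
assert (H0 : 0 < / INR (fact k)) by (apply Rinv_0_lt_compat; lra).
assert (H1 : / INR (fact k) <= 1) by (rewrite <- Rinv_1; apply Rinv_le_contravar; lra).
split; [nra | unfold Rdiv; nra].
Qed.

(** I_0(w) contains only powers of (w/2)^2 = y, so the choice of the root w is immaterial. *)
Lemma abs_series_BesselI_0_sqrt (w y : C) : (w * w = 4 * y)%C ->
  abs_series (pow_term (fact_coef 0) y) (BesselI 0 w).
Proof.
intros Hw.
destruct (ex_abs_series_pow (fact_coef 0) 1 y fact_coef_0_bound) as [l Hl].
replace (BesselI 0 w) with l; [easy|].
symmetry; apply CSeries_unique; destruct Hl as [_ Hl].
revert Hl; apply is_series_ext; intros k.
unfold pow_term, BesselI_term, fact_coef; f_equal.
replace (Z.to_nat (2 * Z.of_nat k + 0)) with (2 * k)%nat by lia.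
rewrite Cpow_mult_r; f_equal.
transitivity (w * w / 4)%C; [rewrite Hw|]; simpl; field.
Qed.

(** * The Laplace integral *)

Lemma is_RInt_gen_0_infty {V : NormedModule R_AbsRing} (f I : R -> V) (l : V) :
  (forall b, is_RInt f 0 b (I b)) ->
  filterlim I (Rbar_locally p_infty) (locally l) ->
  is_RInt_gen f (at_point 0) (Rbar_locally p_infty) l.
Proof.
intros HI Hl P HP.
apply (Filter_prod _ _ _ (fun a => a = 0) (fun b => P (I b))).
- reflexivity.
- now apply Hl.
- intros a b -> Hb; exists (I b); split; [apply HI | exact Hb].
Qed.

Lemma is_lim_exp_half : is_lim (fun t => exp (- t / 2)) p_infty 0.
Proof.
apply (filterlim_comp _ _ _ (fun t => - t / 2) exp _ (Rbar_locally m_infty)).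
- intros P [m Hm]; exists (- 2 * m); intros t Ht; apply Hm; lra.
- apply is_lim_exp_m.
Qed.

Lemma is_derive_exp_half (M t : R) :
  is_derive (fun t => - 2 * M * exp (- t / 2)) t (M * exp (- t / 2)).
Proof. auto_derive; [easy|]; unfold Rdiv; field. Qed.

(** The integrals over [0,b] increase with b and stay below 2M, the integral of the majorant over
    the half-line, so they converge to their supremum. This serves the modulus of the integrand, for
    which no antiderivative is at hand. *)
Lemma ex_RInt_gen_exp_bound (h : R -> R) (M : R) :
  (forall t, continuous h t) ->
  (forall t, 0 <= t -> 0 <= h t <= M * exp (- t / 2)) ->
  ex_RInt_gen h (at_point 0) (Rbar_locally p_infty).
Proof.
intros Hc Hb.
assert (HM : 0 <= M).
{ assert (H := Hb 0 (Rle_refl 0)); replace (- 0 / 2) with 0 in H by field.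
  rewrite exp_0 in H; lra. }
assert (Hex : forall a b, ex_RInt h a b)
  by (intros a b; apply (ex_RInt_continuous (V := R_CompleteNormedModule)); intros; apply Hc).
assert (Hbd : forall b, 0 <= b -> RInt h 0 b <= 2 * M).
{ intros b H.
  apply Rle_trans with (- 2 * M * exp (- b / 2) - - 2 * M * exp (- 0 / 2)).
  - apply (is_RInt_le h (fun t => M * exp (- t / 2)) 0 b); [easy | | |].
    + now apply (RInt_correct (V := R_CompleteNormedModule)).
    + apply (is_RInt_derive (V := R_CompleteNormedModule)
        (fun t => - 2 * M * exp (- t / 2)) (fun t => M * exp (- t / 2))).
      * intros t _; apply is_derive_exp_half.
      * intros t _; apply (ex_derive_continuous (V := R_NormedModule)); auto_derive; easy.
    + intros t Ht; apply Hb; lra.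
  - replace (- 0 / 2) with 0 by field; rewrite exp_0.
    assert (He := exp_pos (- b / 2)); nra. }
destruct (completeness (fun y => exists b, 0 <= b /\ y = RInt h 0 b)) as [l [Hl1 Hl2]].
- exists (2 * M); intros y [b [H ->]]; now apply Hbd.
- exists (RInt h 0 0), 0; split; [lra | easy].
- exists l; apply (is_RInt_gen_0_infty h (fun b => RInt h 0 b)).
  { intros b; now apply (RInt_correct (V := R_CompleteNormedModule)). }
  apply filterlim_locally; intros [eps Heps].
  assert (Hb0 : exists b0, 0 <= b0 /\ l - eps < RInt h 0 b0).
  { apply Classical_Prop.NNPP; intros Hn.
    assert (H : l <= l - eps); [|lra].
    apply Hl2; intros y [b [H ->]]; apply Rnot_lt_le; intros Hlt.
    apply Hn; now exists b. }
  destruct Hb0 as [b0 [H0 H1]]; exists b0; intros b Hlt.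
  assert (H2 : RInt h 0 b <= l) by (apply Hl1; exists b; split; [lra | easy]).
  assert (H3 : RInt h 0 b0 + RInt h b0 b = RInt h 0 b)
    by now apply (RInt_Chasles (V := R_CompleteNormedModule)).
  assert (H4 : 0 <= RInt h b0 b)
    by (apply RInt_ge_0; [lra | easy | intros t Ht; apply Hb; lra]).
  change (Rabs (RInt h 0 b - l) < eps); apply Rabs_def1; lra.
Qed.

Lemma PSeries_div_fact_le (a : nat -> R) (M r t : R) : 0 <= r -> 0 <= t ->
  (forall k, Rabs (a k) <= M * r ^ k) ->
  Rabs (PSeries (fun k => a k / INR (fact k)) t) <= M * exp (r * t).
Proof.
intros Hr Ht H.
assert (Hs := is_series_scal (V := R_NormedModule) M _ _ (is_series_exp (r * t))).
assert (Hle : forall k, Rabs (a k / INR (fact k) * t ^ k) <= M * ((r * t) ^ k / INR (fact k))).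
{ intros k; unfold Rdiv.
  rewrite !Rabs_mult, (Rabs_pos_eq (/ _)), (Rabs_pos_eq (t ^ k)), Rpow_mult_distr
    by (try apply pow_le; try (left; apply Rinv_0_lt_compat, INR_fact_lt_0); easy).
  replace (M * (r ^ k * t ^ k * / INR (fact k)))
    with (M * r ^ k * / INR (fact k) * t ^ k) by ring.
  apply Rmult_le_compat_r; [now apply pow_le|].
  apply Rmult_le_compat_r; [left; apply Rinv_0_lt_compat, INR_fact_lt_0 | easy]. }
unfold PSeries; eapply Rle_trans; [apply Series_Rabs|].
- apply (ex_series_le_R _ (fun k => M * ((r * t) ^ k / INR (fact k)))).
  + intros k; rewrite Rabs_Rabsolu; apply Hle.
  + eexists; apply Hs.
- replace (M * exp (r * t)) with (Series (fun k => M * ((r * t) ^ k / INR (fact k))))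
    by now apply is_series_unique.
  apply Series_le; [|eexists; apply Hs].
  intros k; split; [apply Rabs_pos | apply Hle].
Qed.

(** * Borel transforms and their Laplace integrals *)

(** The tails T_j solve T_j - T_(j+1) = a_j, the equation for the coefficients of the antiderivative
    in [is_RInt_borel_exp]. *)
Definition series_tail (a : nat -> R) (j : nat) : R := Series (fun k => a (j + k)%nat).

Lemma ex_series_shift (a : nat -> R) (M : R)
    (Ha : forall k, Rabs (a k) <= M * (/ 2) ^ k) (j : nat) :
  ex_series (fun k => a (j + k)%nat).
Proof.
apply (ex_series_le_R _ (fun k => M * (/ 2) ^ j * (/ 2) ^ k)).
- intros k; rewrite Rmult_assoc, <- pow_add; apply Ha.
- apply (ex_series_scal (V := R_NormedModule)); eexists; apply is_series_geom.
  rewrite Rabs_pos_eq; lra.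
Qed.

Lemma series_tail_le (a : nat -> R) (M : R)
    (Ha : forall k, Rabs (a k) <= M * (/ 2) ^ k) (j : nat) :
  Rabs (series_tail a j) <= 2 * M * (/ 2) ^ j.
Proof.
assert (Hg : is_series (fun k => M * (/ 2) ^ j * (/ 2) ^ k) (2 * M * (/ 2) ^ j)).
{ replace (2 * M * (/ 2) ^ j) with (M * (/ 2) ^ j * / (1 - / 2)) by field.
  apply (is_series_scal (V := R_NormedModule)), is_series_geom; rewrite Rabs_pos_eq; lra. }
assert (Hle : forall k, Rabs (a (j + k)%nat) <= M * (/ 2) ^ j * (/ 2) ^ k)
  by (intros k; rewrite Rmult_assoc, <- pow_add; apply Ha).
unfold series_tail; eapply Rle_trans; [apply Series_Rabs|].
- apply (ex_series_le_R _ (fun k => M * (/ 2) ^ j * (/ 2) ^ k)); [|eexists; apply Hg].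
  intros k; rewrite Rabs_Rabsolu; apply Hle.
- rewrite <- (is_series_unique _ _ Hg).
  apply Series_le; [|eexists; apply Hg].
  intros k; split; [apply Rabs_pos | apply Hle].
Qed.

Lemma series_tail_S (a : nat -> R) (M : R)
    (Ha : forall k, Rabs (a k) <= M * (/ 2) ^ k) (j : nat) :
  series_tail a j - series_tail a (S j) = a j.
Proof.
unfold series_tail; rewrite Series_incr_1 by apply (ex_series_shift a M Ha).
rewrite Nat.add_0_r.
rewrite (Series_ext (fun k => a (j + S k)%nat) (fun k => a (S j + k)%nat)); [ring|].
intros k; f_equal; lia.
Qed.

(** Borel transform of the series, whose Laplace integral gives back the sum. The bound M 2^(-k) on
    the coefficients limits its growth to M e^(t/2), which e^(-t) outweighs. *)
Definition borel (a : nat -> R) : R -> R := PSeries (fun k => a k / INR (fact k)).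

Lemma continuous_borel_exp (a : nat -> R) (M : R)
    (Ha : forall k, Rabs (a k) <= M * (/ 2) ^ k) (t : R) :
  continuous (fun t => borel a t * exp (- t)) t.
Proof.
apply (continuous_mult (K := R_AbsRing)).
- apply (ex_derive_continuous (V := R_NormedModule)); eexists.
  apply (is_derive_PSeries_div_fact a M (/ 2)); [lra | exact Ha].
- apply (ex_derive_continuous (V := R_NormedModule)); auto_derive; easy.
Qed.

Lemma borel_exp_le (a : nat -> R) (M : R)
    (Ha : forall k, Rabs (a k) <= M * (/ 2) ^ k) (t : R) :
  0 <= t -> Rabs (borel a t * exp (- t)) <= M * exp (- t / 2).
Proof.
intros Ht; rewrite Rabs_mult, (Rabs_pos_eq (exp _)) by (left; apply exp_pos).
replace (- t / 2) with (/ 2 * t + - t) by field; rewrite exp_plus, <- Rmult_assoc.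
apply Rmult_le_compat_r; [left; apply exp_pos|].
apply (PSeries_div_fact_le a); [lra | easy | exact Ha].
Qed.

(* [- exp (- t) * sum_j tail_j t^j / j!] is an antiderivative: the derivatives
   of the two factors contribute [tail_j] and [- tail_(j+1)]. *)
Lemma is_RInt_borel_exp (a : nat -> R) (M : R)
    (Ha : forall k, Rabs (a k) <= M * (/ 2) ^ k) (b : R) :
  is_RInt (fun t => borel a t * exp (- t)) 0 b
    (Series a - borel (series_tail a) b * exp (- b)).
Proof.
pose (T := borel (series_tail a)).
replace (_ - _) with (- (T b * exp (- b)) - - (T 0 * exp (- 0))).
2: { replace (T 0) with (Series a) by (symmetry; apply PSeries_div_fact_0).
     rewrite Ropp_0, exp_0; fold T; ring. }
apply (is_RInt_derive (V := R_CompleteNormedModule) (fun t => - (T t * exp (- t)))).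
- intros t _.
  assert (HT := is_derive_PSeries_div_fact (series_tail a) (2 * M) (/ 2) t
    ltac:(lra) (series_tail_le a M Ha)).
  change (PSeries _) with T in HT at 1.
  assert (ET : ex_derive T t) by (eexists; exact HT).
  auto_derive; [easy|].
  change (Derive (fun x => T x) t) with (Derive T t).
  rewrite (is_derive_unique _ _ _ HT).
  replace (borel a t) with (T t - PSeries (fun k => series_tail a (S k) / INR (fact k)) t); [ring|].
  unfold T, borel; rewrite <- PSeries_minus.
  + apply PSeries_ext; intros k; rewrite <- (series_tail_S a M Ha).
    unfold PS_minus, PS_plus, PS_opp; change (plus ?u (opp ?v)) with (u - v).
    unfold Rdiv; ring.
  + apply (ex_pseries_div_fact (series_tail a) (2 * M) (/ 2));
      [lra | exact (series_tail_le a M Ha)].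
  + apply (ex_pseries_div_fact (fun k => series_tail a (S k)) M (/ 2)); [lra|].
    intros k; eapply Rle_trans; [apply (series_tail_le a M Ha)|]; simpl; right; field.
- intros t _; apply (continuous_borel_exp a M Ha).
Qed.

(** The boundary term is at most 2M e^(b/2) e^(-b) in absolute value, which squeezes it to 0. *)
Lemma filterlim_borel_exp (a : nat -> R) (M : R)
    (Ha : forall k, Rabs (a k) <= M * (/ 2) ^ k) :
  filterlim (fun b => Series a - borel (series_tail a) b * exp (- b))
    (Rbar_locally p_infty) (locally (Series a)).
Proof.
assert (H : is_lim (fun b => Series a + - 2 * M * exp (- b / 2)) p_infty (Series a)
  /\ is_lim (fun b => Series a + 2 * M * exp (- b / 2)) p_infty (Series a)).
{ split.
  - replace (Finite (Series a)) with (Finite (Series a + - 2 * M * 0)) by (f_equal; ring).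
    apply (is_lim_plus' _ _ _ (Series a)); [apply is_lim_const|].
    apply (is_lim_scal_l _ (- 2 * M) p_infty 0), is_lim_exp_half.
  - replace (Finite (Series a)) with (Finite (Series a + 2 * M * 0)) by (f_equal; ring).
    apply (is_lim_plus' _ _ _ (Series a)); [apply is_lim_const|].
    apply (is_lim_scal_l _ (2 * M) p_infty 0), is_lim_exp_half. }
destruct H as [H1 H2].
refine (is_lim_le_le_loc _ _ _ p_infty (Series a) _ H1 H2).
exists 0; intros b Hb.
assert (Hle := PSeries_div_fact_le (series_tail a) (2 * M) (/ 2) b
  ltac:(lra) ltac:(lra) (series_tail_le a M Ha)).
apply Rabs_le_between in Hle.
replace (- b / 2) with (/ 2 * b + - b) by field; rewrite exp_plus.
assert (He := exp_pos (- b)); fold (borel (series_tail a)) in Hle; set (P := borel _ b) in *.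
split; nra.
Qed.

(** Termwise, the integral of e^(-t) t^k/k! is 1. The explicit antiderivatives of the real and
    imaginary parts avoid an interchange of sum and integral. *)
Lemma is_CInt_borel (g : nat -> C) (F : R -> C) (M : R) (J : C) :
  (forall k, Cmod (g k) <= M * (/ 2) ^ k) -> is_series g J ->
  (forall t, is_series (fun k => g k * RtoC (t ^ k / INR (fact k)))%C (F t)) ->
  is_CInt_0_infty (fun t => F t * RtoC (exp (- t)))%C J.
Proof.
intros Hg HJ HF.
assert (G1 : forall k, Rabs (fst (g k)) <= M * (/ 2) ^ k)
  by (intros k; eapply Rle_trans; [apply re_le_Cmod | apply Hg]).
assert (G2 : forall k, Rabs (snd (g k)) <= M * (/ 2) ^ k)
  by (intros k; eapply Rle_trans; [apply Cmod_snd | apply Hg]).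
apply is_series_C in HJ; destruct HJ as [J1 J2].
pose (f1 := fun t => borel (fun k => fst (g k)) t * exp (- t)).
pose (f2 := fun t => borel (fun k => snd (g k)) t * exp (- t)).
assert (E : forall t, (F t * RtoC (exp (- t)))%C = (f1 t, f2 t)).
{ intros t; destruct (proj1 (is_series_C _ _) (HF t)) as [F1 F2].
  unfold f1, f2; unfold Cmult, RtoC; simpl; f_equal.
  - replace (borel _ t) with (fst (F t)); [ring|].
    symmetry; apply is_series_unique; revert F1; apply is_series_ext; intros k.
    simpl; unfold Rdiv; ring.
  - replace (borel _ t) with (snd (F t)); [ring|].
    symmetry; apply is_series_unique; revert F2; apply is_series_ext; intros k.
    simpl; unfold Rdiv; ring. }
assert (C1 : forall t, continuous f1 t) by (apply (continuous_borel_exp _ M G1)).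
assert (C2 : forall t, continuous f2 t) by (apply (continuous_borel_exp _ M G2)).
split.
- apply (ex_RInt_gen_ext_eq (V := R_NormedModule) (fun t => Cmod (f1 t, f2 t)));
    [intros t; now rewrite E|].
  (* The modulus is at most |f1| + |f2|, and each is at most M e^(-t/2). *)
  apply (ex_RInt_gen_exp_bound _ (2 * M)).
  + intros t; unfold Cmod; simpl; apply continuous_sqrt_comp.
    apply (continuous_plus (V := R_NormedModule)).
    * apply (continuous_mult (K := R_AbsRing)); [apply C1|].
      apply (continuous_mult (K := R_AbsRing)); [apply C1 | apply continuous_const].
    * apply (continuous_mult (K := R_AbsRing)); [apply C2|].
      apply (continuous_mult (K := R_AbsRing)); [apply C2 | apply continuous_const].
  + intros t Ht; split; [apply Cmod_ge_0|].
    replace (f1 t, f2 t) with (RtoC (f1 t) + RtoC (f2 t) * Ci)%C.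
    2: { unfold Cplus, Cmult, RtoC, Ci; simpl; f_equal; ring. }
    eapply Rle_trans; [apply Cmod_triangle|].
    rewrite Cmod_mult, !Cmod_R, Cmod_Ci, Rmult_1_r.
    assert (H1 := borel_exp_le _ M G1 t Ht); assert (H2 := borel_exp_le _ M G2 t Ht).
    fold (f1 t) in H1; fold (f2 t) in H2; lra.
- pose (I1 := fun b => Series (fun k => fst (g k)) -
    borel (series_tail (fun k => fst (g k))) b * exp (- b)).
  pose (I2 := fun b => Series (fun k => snd (g k)) -
    borel (series_tail (fun k => snd (g k))) b * exp (- b)).
  apply (is_RInt_gen_0_infty (V := C_R_NormedModule) _ (fun b => (I1 b, I2 b) : C)).
  + intros b; apply (is_RInt_ext (V := C_R_NormedModule) (fun t => (f1 t, f2 t) : C));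
      [intros t _; now rewrite E|].
    apply (is_RInt_fct_extend_pair (U := R_NormedModule) (V := R_NormedModule)
      (fun t => (f1 t, f2 t))); simpl.
    * apply (is_RInt_borel_exp _ M G1).
    * apply (is_RInt_borel_exp _ M G2).
  + rewrite (surjective_pairing J), <- (is_series_unique _ _ J1), <- (is_series_unique _ _ J2).
    assert (L1 := filterlim_borel_exp _ M G1); assert (L2 := filterlim_borel_exp _ M G2).
    apply filterlim_locally; intros eps.
    generalize (filter_and _ _ (proj1 (filterlim_locally _ _) L1 eps)
      (proj1 (filterlim_locally _ _) L2 eps)); apply filter_imp.
    intros b [H1 H2]; now split.
Qed.

(** * The sum of the cubes *)

Lemma is_series_window_sum {K : AbsRing} {V : NormedModule K}
    (f : Z -> nat -> V) (s : Z -> V) (L : nat) :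
  (forall n, is_series (f n) (s n)) ->
  is_series (fun k => window_sum plus L (fun n => f n k)) (window_sum plus L s).
Proof.
intros H; induction L as [|L IH]; simpl; [apply H|].
repeat apply (is_series_plus (V := V)); [exact IH | apply H | apply H].
Qed.

(** The negative half starts at -1, so its sum up to index L ends at -(L+1). The radius is a
    successor because [sum_n] is never empty. *)
Lemma window_sum_S_sum_n {G : AbelianMonoid} (f : Z -> G) (L : nat) :
  window_sum plus (S L) f =
  plus (sum_n (fun k => f (Z.of_nat k)) (S L)) (sum_n (fun k => f (- Z.of_nat (S k))%Z) L).
Proof.
induction L as [|L IH].
- cbn [window_sum]; now rewrite sum_Sn, !sum_O.
- change (window_sum plus (S (S L)) f) with (plus (plus (window_sum plus (S L) f)
    (f (Z.of_nat (S (S L))))) (f (- Z.of_nat (S (S L)))%Z)).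
  rewrite IH, (sum_Sn _ (S L)), (sum_Sn (fun k => f (- Z.of_nat (S k))%Z) L).
  rewrite <- !plus_assoc; f_equal.
  rewrite !plus_assoc; f_equal; apply plus_comm.
Qed.

Lemma ex_series_nneg_bounded (a : nat -> R) (M : R) :
  (forall k, 0 <= a k) -> (forall n, sum_n a n <= M) -> ex_series a.
Proof.
intros Ha HM.
destruct (ex_finite_lim_seq_incr (sum_n a) M) as [l Hl]; [|easy|now exists l].
intros n; rewrite sum_Sn; change (plus ?u ?v) with (u + v).
assert (H := Ha (S n)); lra.
Qed.

Lemma sum_n_nneg (a : nat -> R) (n : nat) : (forall k, 0 <= a k) -> 0 <= sum_n a n.
Proof. intros H; rewrite sum_n_Reals; now apply cond_pos_sum. Qed.

Lemma sum_n_le_window_sum (f : Z -> R) (N : nat) : (forall n, 0 <= f n) ->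
  sum_n (fun k => f (Z.of_nat k)) N <= window_sum Rplus (S N) f /\
  sum_n (fun k => f (- Z.of_nat (S k))%Z) N <= window_sum Rplus (S N) f.
Proof.
intros Hf.
assert (E := window_sum_S_sum_n (G := R_AbelianMonoid) f N).
change (window_sum Rplus (S N) f = sum_n (fun k => f (Z.of_nat k)) (S N)
  + sum_n (fun k => f (- Z.of_nat (S k))%Z) N) in E.
rewrite E.
assert (Hp := sum_n_nneg (fun k => f (Z.of_nat k)) N ltac:(intros; apply Hf)).
assert (Hn := sum_n_nneg (fun k => f (- Z.of_nat (S k))%Z) N ltac:(intros; apply Hf)).
rewrite sum_Sn; change (plus ?u ?v) with (u + v).
assert (H := Hf (Z.of_nat (S N))); split; lra.
Qed.

Lemma pow_div_fact_le_exp (r : R) (k : nat) : 0 <= r -> r ^ k / INR (fact k) <= exp r.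
Proof.
intros Hr.
apply Rle_trans with (2 := exp_ge_taylor r k Hr).
destruct k as [|k]; [simpl; lra|].
rewrite tech5.
assert (H : 0 <= sum_f_R0 (fun i => r ^ i / INR (fact i)) k); [|lra].
apply cond_pos_sum; intros i; apply Rmult_le_pos; [now apply pow_le|].
left; apply Rinv_0_lt_compat, INR_fact_lt_0.
Qed.

Lemma abs_series_BesselI_cube (n : Z) (x : C) :
  abs_series (pow_term (bessel3_coef n n n) (x / 2)%C) (BesselI n x ^ 3)%C.
Proof.
replace (BesselI n x ^ 3)%C with (BesselI n x * (BesselI n x * BesselI n x))%C
  by (simpl; ring).
repeat apply abs_series_pow_mult; apply abs_series_BesselI.
Qed.

Lemma lazy_walk_coef_eq_table_0 (L k : nat) : (k <= L)%nat ->
  lazy_walk_coef L 0 0 0 k = table_coef 0 0 0 k.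
Proof. intros Hk; apply (lazy_walk_coef_eq_table L k 0 0 0); lia. Qed.

(** Sign and size of the closed form are inherited from the lazy walk in the window L = k, where the
    two agree. *)
Lemma table_coef_nneg (k : nat) : 0 <= table_coef 0 0 0 k.
Proof. rewrite <- (lazy_walk_coef_eq_table_0 k k) by lia; apply lazy_walk_coef_nneg. Qed.

Lemma table_coef_le (k : nat) : table_coef 0 0 0 k <= 9 ^ k / INR (fact k).
Proof. rewrite <- (lazy_walk_coef_eq_table_0 k k) by lia; apply lazy_walk_coef_le. Qed.

(** With y = x/2, dividing the k-th term of J by k! leaves [fact3_coef] times y^k, so the Borel
    transform at t is the series of I_0^3 at the root of 4yt = 2xt. *)
Lemma is_CInt_BesselI_cube (x : C) (s : C -> C) (J : C) : is_sqrt_fun s ->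
  is_series (pow_term (table_coef 0 0 0) (x / 2)%C) J ->
  is_CInt_0_infty
    (fun t : R => BesselI 0 (s (2 * x * t)) ^ 3 * RtoC (exp (- t)))%C J.
Proof.
intros hs HJ.
set (r := Cmod (x / 2)%C); assert (Hr : 0 <= r) by apply Cmod_ge_0.
(* The constant comes from (9r)^k/k! = 2^(-k) (18r)^k/k!, where the last factor is at most
   e^(18r). *)
apply (is_CInt_borel (pow_term (table_coef 0 0 0) (x / 2)%C) _ (exp (18 * r))).
- intros k; rewrite Cmod_pow_term by apply table_coef_nneg; fold r.
  replace (/ 2) with (9 / 18) by field.
  apply Rle_trans with ((18 * r) ^ k / INR (fact k) * (9 / 18) ^ k).
  + replace ((18 * r) ^ k / INR (fact k) * (9 / 18) ^ k)
      with (9 ^ k / INR (fact k) * r ^ k).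
    * apply Rmult_le_compat_r; [now apply pow_le | apply table_coef_le].
    * unfold Rdiv; rewrite !Rpow_mult_distr, pow_inv; field.
      split; [apply pow_nonzero; lra | apply INR_fact_neq_0].
  + apply Rmult_le_compat_r; [apply pow_le; lra|].
    apply pow_div_fact_le_exp; lra.
- exact HJ.
- intros t.
  assert (Hw : (s (2 * x * t) * s (2 * x * t) = 4 * (x / 2 * t))%C)
    by (rewrite hs; field).
  assert (HI := abs_series_BesselI_0_sqrt _ _ Hw).
  assert (H3 := abs_series_pow_mult _ _ _ _ _ HI (abs_series_pow_mult _ _ _ _ _ HI HI)).
  destruct H3 as [_ H3].
  replace (BesselI 0 (s (2 * x * t)) ^ 3)%C with (BesselI 0 (s (2 * x * t)) *
    (BesselI 0 (s (2 * x * t)) * BesselI 0 (s (2 * x * t))))%C by (simpl; ring).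
  revert H3; apply is_series_ext; intros k.
  change (PS_mult (fact_coef 0) _) with (fact3_coef 0 0 0).
  unfold pow_term, table_coef; rewrite Cpow_mult_l, <- RtoC_pow.
  match goal with |- ?u = ?v => change (@eq C u v) end.
  transitivity (RtoC (fact3_coef 0 0 0 k * t ^ k) * (x / 2) ^ k)%C;
    [rewrite RtoC_mult; ring|].
  transitivity (RtoC (INR (fact k) * fact3_coef 0 0 0 k * (t ^ k / INR (fact k)))
    * (x / 2) ^ k)%C; [|rewrite (RtoC_mult (_ * _)); ring].
  do 2 f_equal; field; apply INR_fact_neq_0.
Qed.

(** All coefficients are nonnegative, so the moduli are bounded by the same series at r = |x/2|.
    Summed over the window they give [walk_coef], bounded by 6^k/k! for every L. Absolute
    summability over Z follows. *)
Lemma window_sum_Cmod_cube_le (x : C) (L : nat) :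
  window_sum Rplus L (fun n => Cmod (BesselI n x ^ 3)%C) <= exp (6 * Cmod (x / 2)%C).
Proof.
set (r := Cmod (x / 2)%C); assert (Hr : 0 <= r) by apply Cmod_ge_0.
pose (u := fun n k => Cmod (pow_term (bessel3_coef n n n) (x / 2)%C k)).
assert (Hu : forall n, is_series (u n) (Series (u n)))
  by (intros n; apply Series_correct, abs_series_BesselI_cube).
apply Rle_trans with (window_sum Rplus L (fun n => Series (u n))).
- apply window_sum_le; intros n.
  destruct (abs_series_BesselI_cube n x) as [_ H].
  apply (Cmod_is_series_le _ (u n) _ _ H (Hu n)); intros k; apply Rle_refl.
- assert (H : is_series (fun k => window_sum Rplus L (fun n => u n k))
    (window_sum Rplus L (fun n => Series (u n))))
    by exact (is_series_window_sum (V := R_NormedModule) u (fun n => Series (u n)) L Hu).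
  rewrite <- (is_series_unique _ _ H), <- (is_series_unique _ _ (is_series_exp (6 * r))).
  apply Series_le; [|eexists; apply is_series_exp].
  intros k; split.
  + apply window_sum_nneg; intros n; apply Cmod_ge_0.
  + rewrite (window_sum_ext L _ (fun n => r ^ k * bessel3_coef n n n k)).
    * rewrite window_sum_scal.
      change (window_sum Rplus L _) with (walk_coef L 0 0 0 k).
      replace ((6 * r) ^ k / INR (fact k)) with (r ^ k * (6 ^ k / INR (fact k)))
        by (rewrite Rpow_mult_distr; unfold Rdiv; ring).
      apply Rmult_le_compat_l; [now apply pow_le | apply walk_coef_le].
    * intros n; unfold u; rewrite Cmod_pow_term by apply bessel3_coef_nneg; fold r; ring.
Qed.

Lemma pow_term_window_sum (f : Z -> nat -> R) (y : C) (L k : nat) :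
  pow_term (fun k => window_sum Rplus L (fun n => f n k)) y k =
  window_sum Cplus L (fun n => pow_term (f n) y k).
Proof.
induction L as [|L IH]; [reflexivity|].
cbn [window_sum]; rewrite <- IH; unfold pow_term; cbn [window_sum].
rewrite !RtoC_plus; ring.
Qed.

Lemma abs_series_window_BesselI_cube (x : C) (L : nat) :
  abs_series (pow_term (walk_coef L 0 0 0) (x / 2)%C)
    (window_sum Cplus L (fun n => BesselI n x ^ 3)%C).
Proof.
destruct (ex_abs_series_pow (walk_coef L 0 0 0) 6 (x / 2)%C) as [l Hl].
{ intros k; split; [apply walk_coef_nneg | apply walk_coef_le]. }
replace (window_sum _ _ _) with l; [easy|].
apply (is_series_C_unique _ _ _ (proj2 Hl)).
assert (H := is_series_window_sum (V := C_NormedModule)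
  (fun n => pow_term (bessel3_coef n n n) (x / 2)%C) (fun n => BesselI n x ^ 3)%C L
  (fun n => proj2 (abs_series_BesselI_cube n x))).
revert H; apply is_series_ext; intros k.
exact (eq_sym (pow_term_window_sum (fun n => bessel3_coef n n n) (x / 2)%C L k)).
Qed.

(** * Passage from finite windows to the whole sum *)

Lemma exp_tail_lim (r : R) :
  is_lim_seq (fun L => exp r - sum_n (fun k => r ^ k / INR (fact k)) L) 0.
Proof.
replace (Finite 0) with (Finite (exp r - exp r)) by (f_equal; ring).
apply is_lim_seq_minus'; [apply is_lim_seq_const | exact (is_series_exp r)].
Qed.

(** The product on the left has the coefficients [lazy_walk_coef L], equal to those of J up to order
    L. What remains is dominated by a tail of the series of e^(9r), r = |x/2|. *)
Lemma window_BesselI_cube_tail (x J : C) (L : nat) :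
  abs_series (pow_term (table_coef 0 0 0) (x / 2)%C) J ->
  Cmod (Cexp (3 * x / 2) * window_sum Cplus L (fun n => BesselI n x ^ 3) - J)%C <=
  exp (9 * Cmod (x / 2)%C) - sum_n (fun k => (9 * Cmod (x / 2)%C) ^ k / INR (fact k)) L.
Proof.
intros HJ.
replace (3 * x / 2)%C with (3 * (x / 2))%C by field.
set (y := (x / 2)%C) in *; set (r := Cmod y); assert (Hr : 0 <= r) by apply Cmod_ge_0.
assert (H := abs_series_pow_mult _ _ _ _ _ (abs_series_exp3 y)
  (abs_series_window_BesselI_cube x L)).
change (PS_mult exp3_coef (walk_coef L 0 0 0)) with (lazy_walk_coef L 0 0 0) in H.
assert (Hd := is_series_minus _ _ _ _ (proj2 H) (proj2 HJ)).
apply (is_series_drop_zeros _ _ (S L)) in Hd.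
2: { intros k Hk; unfold pow_term; rewrite (lazy_walk_coef_eq_table_0 L k) by lia.
     apply (plus_opp_r (G := C_AbelianGroup)). }
assert (He : is_series (fun k => (9 * r) ^ (S L + k) / INR (fact (S L + k)))
  (exp (9 * r) - sum_n (fun k => (9 * r) ^ k / INR (fact k)) L)).
{ apply (is_series_incr_n (fun k => (9 * r) ^ k / INR (fact k)) (S L)); [lia|].
  simpl pred; change (plus ?u ?v) with (u + v).
  rewrite Rplus_comm, Rplus_minus; apply is_series_exp. }
refine (Cmod_is_series_le _ _ _ _ Hd He _); intros k.
generalize (S L + k)%nat; intros j.
change (Cmod (pow_term (lazy_walk_coef L 0 0 0) y j - pow_term (table_coef 0 0 0) y j)%C
  <= (9 * r) ^ j / INR (fact j)).
replace (_ - _)%C with (RtoC (lazy_walk_coef L 0 0 0 j - table_coef 0 0 0 j) * y ^ j)%C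
  by (unfold pow_term; rewrite RtoC_minus; ring).
rewrite Cmod_mult, Cmod_pow, Cmod_R; fold r.
replace ((9 * r) ^ j / INR (fact j)) with (9 ^ j / INR (fact j) * r ^ j)
  by (rewrite Rpow_mult_distr; unfold Rdiv; ring).
apply Rmult_le_compat_r; [now apply pow_le|].
(* Both coefficients lie in [0, 9^j/j!], so their difference is bounded by its length without a
   factor 2. *)
assert (T0 := table_coef_nneg j); assert (T1 := table_coef_le j).
assert (L0 := lazy_walk_coef_nneg L 0 0 0 j); assert (L1 := lazy_walk_coef_le L 0 0 0 j).
apply Rabs_le; lra.
Qed.

Theorem theorem4 (x : C) (s : C -> C) (hs : is_sqrt_fun s) :
  exists S J : C,
    is_Zsum (fun n : Z => BesselI n x ^ 3)%C S /\
    is_CInt_0_infty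
      (fun t : R => BesselI 0 (s (2 * x * t)) ^ 3 * RtoC (exp (- t)))%C J /\
    (Cexp (3 * x / 2) * S = J)%C.
Proof.
(* J is introduced as the sum of the closed-form series. The integral and the Bessel side are each
   compared with it. *)
destruct (ex_abs_series_pow (table_coef 0 0 0) 9 (x / 2)%C) as [J HJ].
{ intros k; split; [apply table_coef_nneg | apply table_coef_le]. }
pose (a := fun n : Z => (BesselI n x ^ 3)%C).
assert (Hp : ex_series (fun k => Cmod (a (Z.of_nat k)))).
{ apply (ex_series_nneg_bounded _ (exp (6 * Cmod (x / 2)%C))); [intros; apply Cmod_ge_0|].
  intros N; eapply Rle_trans; [|apply (window_sum_Cmod_cube_le x (S N))].
  apply (sum_n_le_window_sum (fun n => Cmod (a n))); intros; apply Cmod_ge_0. }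
assert (Hn : ex_series (fun k => Cmod (a (- Z.of_nat (S k))%Z))).
{ apply (ex_series_nneg_bounded _ (exp (6 * Cmod (x / 2)%C))); [intros; apply Cmod_ge_0|].
  intros N; eapply Rle_trans; [|apply (window_sum_Cmod_cube_le x (S N))].
  apply (sum_n_le_window_sum (fun n => Cmod (a n))); intros; apply Cmod_ge_0. }
destruct (ex_abs_series (fun k => a (Z.of_nat k)) _ (fun k => Rle_refl _) Hp) as [lp Hlp].
destruct (ex_abs_series (fun k => a (- Z.of_nat (S k))%Z) _ (fun k => Rle_refl _) Hn) as [ln Hln].
exists (lp + ln)%C, J; split; [|split].
- split; [exact Hp | split; [exact Hn|]]; exists lp, ln.
  split; [apply Hlp | split; [apply Hln | reflexivity]].
- apply (is_CInt_BesselI_cube x s J hs (proj2 HJ)).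
- set (E := Cexp (3 * x / 2)%C).
  (* The window sums converge to lp + ln, so the error of the window tends to the modulus of the
     difference of the two sides. The exponential tail bounds that error and tends to 0. *)
  assert (Hlim : is_lim_seq (fun L => Cmod (E * window_sum Cplus (S L) a - J)%C)
    (Cmod (E * (lp + ln) - J)%C)).
  { apply (filterlim_comp _ _ _ (fun L => (E * window_sum Cplus (S L) a - J)%C) Cmod
      eventually (locally (E * (lp + ln) - J)%C)).
    2: apply (filterlim_norm (V := C_NormedModule)).
    apply (filterlim_comp_2 (G := locally (E * (lp + ln))%C) (H := locally (- J)%C)
      (fun L => E * window_sum Cplus (S L) a)%C (fun _ => - J)%C Cplus);
      [| apply filterlim_const |
       apply (filterlim_plus (V := C_NormedModule) (E * (lp + ln))%C (- J)%C)].
    apply (filterlim_comp _ _ _ (fun L => window_sum Cplus (S L) a) (Cmult E) eventually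
      (locally (lp + ln)%C)).
    2: apply (filterlim_scal_r (V := C_NormedModule) E (lp + ln)%C).
    apply (filterlim_ext (fun L => plus (sum_n (fun k => a (Z.of_nat k)) (S L))
      (sum_n (fun k => a (- Z.of_nat (S k))%Z) L) : C)).
    { intros L; symmetry; apply (window_sum_S_sum_n (G := C_AbelianGroup)). }
    apply (filterlim_comp_2 (G := locally lp) (H := locally ln));
      [| exact (proj2 Hln) | apply (filterlim_plus (V := C_NormedModule) lp ln)].
    apply (filterlim_comp _ _ _ S (sum_n (fun k => a (Z.of_nat k))) eventually eventually);
      [|exact (proj2 Hlp)].
    intros P [N HN]; exists N; intros n Hlt; apply HN; lia. }
  assert (H0 := is_lim_seq_le _ _ _ _
    (fun L => window_BesselI_cube_tail x J (S L) HJ) Hlim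
    (proj1 (is_lim_seq_incr_1 _ _) (exp_tail_lim (9 * Cmod (x / 2)%C)))).
  assert (HE : (E * (lp + ln) - J)%C = RtoC 0).
  { apply Cmod_eq_0; simpl in H0; assert (H1 := Cmod_ge_0 (E * (lp + ln) - J)%C); lra. }
  replace J with (J + 0)%C by ring; rewrite <- HE; ring.
Qed.
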